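(* Let $p$ be an odd prime and let $G$ be a finite VZ $p$-group. Let $m_1$, $m_2$ and $m_3$ denote the exponents of $G/G'$, $Z(G)$ and $Z(G)/G'$, respectively. Then the Wedderburn decomposition of $\mathbb{Q}G$ is $$\mathbb{Q}G \cong \bigoplus_{d_1\mid m_1}a_{d_1}\mathbb{Q}(\zeta_{d_1})\ \oplus\bigoplus_{d_2\mid m_2,\ d_2 \nmid m_3} a_{d_2}M_{|G/Z(G)|^{1/2}}(\mathbb{Q}(\zeta_{d_2}))\ \oplus\bigoplus_{d_2\mid m_2,\ d_2\mid m_3}(a_{d_2}-a_{d_2}')M_{|G/Z(G)|^{1/2}}(\mathbb{Q}(\zeta_{d_2})),$$ where $a_{d_1}$ is the number of cyclic subgroups of $G/G'$ of order $d_1$, $a_{d_2}$ is the number of cyclic subgroups of $Z(G)$ of order $d_2$, and $a_{d_2}'$ is the number of cyclic subgroups of $Z(G)/G'$ of order $d_2$.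
   Context: A finite group $G$ is a VZ-group if every non-linear irreducible complex character of $G$ vanishes on $G\setminus Z(G)$. In this case $G'\subseteq Z(G)$ and $|G/Z(G)|$ is a perfect square. A VZ $p$-group is a VZ-group that is a $p$-group. $G'$ is the commutator subgroup, $Z(G)$ the center, $\zeta_d$ a primitive $d$-th root of unity, $M_n(D)$ the ring of $n\times n$ matrices over $D$, and for an integer $a\ge 0$, $aR$ denotes the direct sum of $a$ copies of the algebra $R$. The coefficients $a_{d_1}$ (counting in $G/G'$) and $a_{d_2}$ (counting in $Z(G)$) refer to different groups. The isomorphism is of $\mathbb{Q}$-algebras. *)

(* Defs.v *)
From HB Require Import structures.
From mathcomp Require Import all_boot all_order all_algebra.
From mathcomp Require Import all_fingroup all_solvable all_field all_character.

Set Implicit Arguments.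
Unset Strict Implicit.
Unset Printing Implicit Defensive.

Import GroupScope GRing.Theory.
Local Open Scope ring_scope.

(* f stands for the formal sum of the f x * x over x in gT.                   *)
Definition group_algebra (R : comNzRingType) (gT : finGroupType) : Type :=
  {ffun gT -> R}.

Section GroupAlgebra.

Variables (R : comNzRingType) (gT : finGroupType).

Local Notation RG := (group_algebra R gT).

HB.instance Definition _ := GRing.Lmodule.copy RG {ffun gT -> R^o}.

Definition ga_one : RG := [ffun x => (x == 1%g)%:R].

Definition ga_mul (f g : RG) : RG :=
  [ffun x => \sum_y f y * g (y^-1 * x)%g].

Fact ga_mulA : associative ga_mul.
Proof.
move=> f g h; apply/ffunP=> x; rewrite !ffunE.
under eq_bigr => y _ do rewrite ffunE mulr_sumr.
under [RHS]eq_bigr => y _ do rewrite ffunE mulr_suml.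
rewrite [RHS]exchange_big /=; apply: eq_bigr => y _.
rewrite (reindex_inj (mulgI y^-1%g)) /=; apply: eq_bigr => z _.
by rewrite invMg invgK mulrA !mulgA mulgK.
Qed.

Fact ga_mul1 : left_id ga_one ga_mul.
Proof.
move=> f; apply/ffunP=> x; rewrite !ffunE (bigD1 1%g) //= ffunE eqxx mul1r.
rewrite invg1 mul1g big1 ?addr0 // => y /negPf ny.
by rewrite ffunE ny mul0r.
Qed.

Fact ga_mulr1 : right_id ga_one ga_mul.
Proof.
move=> f; apply/ffunP=> x; rewrite !ffunE (bigD1 x) //= ffunE mulVg eqxx mulr1.
rewrite big1 ?addr0 // => y /negPf ny.
by rewrite ffunE -eq_mulVg1 ny mulr0.
Qed.

Fact ga_mulDl : left_distributive ga_mul +%R.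
Proof.
move=> f g h; apply/ffunP=> x; rewrite !ffunE -big_split /=.
by apply: eq_bigr => y _; rewrite ffunE mulrDl.
Qed.

Fact ga_mulDr : right_distributive ga_mul +%R.
Proof.
move=> f g h; apply/ffunP=> x; rewrite !ffunE -big_split /=.
by apply: eq_bigr => y _; rewrite ffunE mulrDr.
Qed.

Fact ga_one_neq0 : ga_one != 0.
Proof. by apply/eqP=> /ffunP/(_ 1%g)/eqP; rewrite !ffunE eqxx oner_eq0. Qed.

HB.instance Definition _ := GRing.Zmodule_isNzRing.Build RG
  ga_mulA ga_mul1 ga_mulr1 ga_mulDl ga_mulDr ga_one_neq0.

Fact ga_scaleAl (a : R) (f g : RG) : a *: (f * g) = (a *: f) * g.
Proof.
apply/ffunP=> x; rewrite !ffunE scaler_sumr.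
by apply: eq_bigr => y _; rewrite ffunE scalerAl.
Qed.

Fact ga_scaleAr (a : R) (f g : RG) : a *: (f * g) = f * (a *: g).
Proof.
apply/ffunP=> x; rewrite !ffunE scaler_sumr.
by apply: eq_bigr => y _; rewrite ffunE scalerAr.
Qed.

HB.instance Definition _ := GRing.Lmodule_isLalgebra.Build R RG ga_scaleAl.
HB.instance Definition _ := GRing.Lalgebra_isAlgebra.Build R RG ga_scaleAr.

End GroupAlgebra.

(* Only a pzRingType and an lmodType R: the library's algType excludes the     *)
(* zero algebra, which is the sum over an empty I.                            *)
Definition dsum (R : pzRingType) (I : finType) (A : I -> algType R) : Type :=
  {dffun forall i, A i}.

Section DirectSum.

Variables (R : pzRingType) (I : finType) (A : I -> algType R).

Local Notation S := (dsum A).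

HB.instance Definition _ := Choice.copy S {dffun forall i, A i}.

Definition ds_zero : S := [ffun i => 0 : A i].
Definition ds_opp (f : S) : S := [ffun i => - f i : A i].
Definition ds_add (f g : S) : S := [ffun i => f i + g i : A i].
Definition ds_one : S := [ffun i => 1 : A i].
Definition ds_mul (f g : S) : S := [ffun i => f i * g i : A i].
Definition ds_scale (a : R) (f : S) : S := [ffun i => a *: f i : A i].

Fact ds_addA : associative ds_add.
Proof. by move=> f g h; apply/ffunP=> i; rewrite !ffunE addrA. Qed.
Fact ds_addC : commutative ds_add.
Proof. by move=> f g; apply/ffunP=> i; rewrite !ffunE addrC. Qed.
Fact ds_add0 : left_id ds_zero ds_add.
Proof. by move=> f; apply/ffunP=> i; rewrite !ffunE add0r. Qed.
Fact ds_addN : left_inverse ds_zero ds_opp ds_add.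
Proof. by move=> f; apply/ffunP=> i; rewrite !ffunE addNr. Qed.

HB.instance Definition _ := GRing.isZmodule.Build S
  ds_addA ds_addC ds_add0 ds_addN.

Fact ds_mulA : associative ds_mul.
Proof. by move=> f g h; apply/ffunP=> i; rewrite !ffunE mulrA. Qed.
Fact ds_mul1 : left_id ds_one ds_mul.
Proof. by move=> f; apply/ffunP=> i; rewrite !ffunE mul1r. Qed.
Fact ds_mulr1 : right_id ds_one ds_mul.
Proof. by move=> f; apply/ffunP=> i; rewrite !ffunE mulr1. Qed.
Fact ds_mulDl : left_distributive ds_mul +%R.
Proof. by move=> f g h; apply/ffunP=> i; rewrite !ffunE mulrDl. Qed.
Fact ds_mulDr : right_distributive ds_mul +%R.
Proof. by move=> f g h; apply/ffunP=> i; rewrite !ffunE mulrDr. Qed.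

HB.instance Definition _ := GRing.Zmodule_isPzRing.Build S
  ds_mulA ds_mul1 ds_mulr1 ds_mulDl ds_mulDr.

Fact ds_scaleA a b f : ds_scale a (ds_scale b f) = ds_scale (a * b) f.
Proof. by apply/ffunP=> i; rewrite !ffunE scalerA. Qed.
Fact ds_scale1 : left_id 1 ds_scale.
Proof. by move=> f; apply/ffunP=> i; rewrite !ffunE scale1r. Qed.
Fact ds_scaleDr : right_distributive ds_scale +%R.
Proof. by move=> a f g; apply/ffunP=> i; rewrite !ffunE scalerDr. Qed.
Fact ds_scaleDl f : {morph ds_scale^~ f : a b / a + b}.
Proof. by move=> a b; apply/ffunP=> i; rewrite !ffunE scalerDl. Qed.

HB.instance Definition _ := GRing.Zmodule_isLmodule.Build R S
  ds_scaleA ds_scale1 ds_scaleDr ds_scaleDl.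

End DirectSum.

(* a A denotes the direct sum of a copies of A; seq_sub s forgets repetitions *)
(* in s, so s should be duplicate-free.                                       *)
Notation "\bigoplus_ ( d <- s ) a • A" :=
  (dsum (fun di : {i : seq_sub s & 'I_((fun d : nat => a) (ssval i))} =>
           (fun d : nat => A : algType _) (ssval (tag di))))
  (at level 41, d, s at level 50, a at level 39, A at level 41) : type_scope.

Notation "A ⊕ B" := (A * B)%type
  (at level 50, left associativity, only parsing) : type_scope.

(* The n x n matrices over A, for n > 0, written in the successor form needed *)
(* to have 1 != 0. The library makes 'M[A]_n a module over A only; the alias  *)
(* carries the R-algebra structure.                                           *)
Definition mxalg (R : pzRingType) (n : nat) (A : algType R) : Type :=
  'M[A]_n.-1.+1.

Section MatrixAlgebra.

Variables (R : pzRingType) (n : nat) (A : algType R).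

Local Notation M := (mxalg n A).

HB.instance Definition _ := GRing.NzRing.copy M 'M[A]_n.-1.+1.

Definition mxa_scale (a : R) (X : M) : M := \matrix_(i, j) (a *: X i j).

Fact mxa_scaleA a b X : mxa_scale a (mxa_scale b X) = mxa_scale (a * b) X.
Proof. by apply/matrixP=> i j; rewrite !mxE scalerA. Qed.
Fact mxa_scale1 : left_id 1 mxa_scale.
Proof. by move=> X; apply/matrixP=> i j; rewrite !mxE scale1r. Qed.
Fact mxa_scaleDr : right_distributive mxa_scale +%R.
Proof. by move=> a X Y; apply/matrixP=> i j; rewrite !mxE scalerDr. Qed.
Fact mxa_scaleDl X : {morph mxa_scale^~ X : a b / a + b}.
Proof. by move=> a b; apply/matrixP=> i j; rewrite !mxE scalerDl. Qed.

HB.instance Definition _ := GRing.Zmodule_isLmodule.Build R M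
  mxa_scaleA mxa_scale1 mxa_scaleDr mxa_scaleDl.

Fact mxa_scaleAl (a : R) (X Y : M) : a *: (X * Y) = (a *: X) * Y.
Proof.
apply/matrixP=> i j; rewrite !mxE scaler_sumr.
by apply: eq_bigr => k _; rewrite mxE scalerAl.
Qed.
Fact mxa_scaleAr (a : R) (X Y : M) : a *: (X * Y) = X * (a *: Y).
Proof.
apply/matrixP=> i j; rewrite !mxE scaler_sumr.
by apply: eq_bigr => k _; rewrite mxE scalerAr.
Qed.

HB.instance Definition _ := GRing.Lmodule_isLalgebra.Build R M mxa_scaleAl.
HB.instance Definition _ := GRing.Lalgebra_isAlgebra.Build R M mxa_scaleAr.

End MatrixAlgebra.

Definition zeta (d : nat) : algC := sval (C_prim_root_exists (ltn0Sn d.-1)).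

Lemma zetaP (d : nat) : (0 < d)%N -> d.-primitive_root (zeta d).
Proof.
by case: d => // d _; rewrite /zeta; case: (C_prim_root_exists _).
Qed.

(* subFExtend iota z q is the subfield generated by z only if q is a nonzero  *)
(* polynomial having z as a root; this is Qzeta_root.                         *)
Definition Qzeta (d : nat) :=
  subFExtend (@ratr algC) (zeta d) (map_poly intr 'Phi_d).

HB.instance Definition _ (d : nat) := GRing.Field.on (Qzeta d).
HB.instance Definition _ (d : nat) := GRing.Algebra.on (Qzeta d).

Lemma Qzeta_root (d : nat) : (0 < d)%N ->
  (map_poly intr 'Phi_d : {poly rat}) != 0 /\
  root (map_poly (@ratr algC) (map_poly intr 'Phi_d)) (zeta d).
Proof.
move=> d_gt0; have prim_z := zetaP d_gt0; split.
  by rewrite monic_neq0 // monic_map // Cyclotomic_monic.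
rewrite -map_poly_comp (eq_map_poly (fun x => ratr_int _ x)).
by rewrite (Cintr_Cyclotomic prim_z) root_cyclotomic.
Qed.

(* 'chi_i ranges over all irreducible complex characters of G: their values    *)
(* are algebraic, and the library takes them in algC.                         *)
Definition VZ_group (gT : finGroupType) (G : {group gT}) : Prop :=
  forall i : Iirr G, 'chi_i \isn't a linear_char ->
    {in G :\: 'Z(G), forall g, 'chi_i g = 0}.

Definition num_cyclic_subgroups (gT : finGroupType) (H : {group gT}) (d : nat) :
    nat :=
  #|[set K in subgroups H | cyclic K && (#|K| == d)]|.

(* Main.v *)
From HB Require Import structures.
From Stdlib Require PeanoNat.
Require Import Defs.
From mathcomp Require Import all_boot all_order all_algebra.
From mathcomp Require Import all_fingroup all_solvable all_field all_character.

Set Implicit Arguments.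
Unset Strict Implicit.
Unset Printing Implicit Defensive.

Import GroupScope GRing.Theory Num.Theory.
Local Open Scope group_scope.

(** Write Z for the center of G, n for the square root of the index of Z, and,
for a finite group H, call dual of H the group of its linear characters.

The decomposition comes from an explicit algebra morphism whose components are
representations of G over cyclotomic fields, one for each cyclic subgroup of
the dual of G, and one for each cyclic subgroup of the dual of Z whose
characters are not trivial on G'. Two characters that generate the same cyclic
group are conjugate under an automorphism of the complex numbers, so each
component accounts for a full Galois orbit of characters.

- Representations. Column orthogonality shows that the class of an element g
  outside Z is the whole coset g G' ([vz_commutator]). Hence G' is contained in
  Z, and for a linear character lambda of Z that is not trivial on G' the
  pairing sending g and h to lambda of their commutator is nondegenerate
  modulo Z. If lambda has order d, the central character lambda is realized in
  degree n over Q(zeta_d) itself, without any larger root of unity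
  ([vz_repr]). For that, take a subgroup A containing Z that is maximal among
  those to which lambda extends with values among the d-th roots of unity
  ([exists_lagrangian]); A is its own orthogonal for the pairing, its index
  is n, and the monomial representation induced from the extension is the
  required one. The prime p has to be odd here, to make the map sending x to
  the image of its p-th power multiplicative. Since the pairing is
  nondegenerate, the trace of this representation is n times lambda on Z and
  vanishes elsewhere.

- Injectivity. The regular character of G is a combination of the linear
  characters of G and of the traces above ([regular_character_sum]). An
  element of the rational group algebra that is killed by all components is
  therefore killed by the regular character, together with all its translates,
  and is zero.

- Surjectivity. It remains to compare rational dimensions. Counting pairs of an
  element and a character shows that an abelian quotient H / N has as many
  elements of each order as the group of linear characters of H trivial on N
  ([card_dual_order]). This turns the numbers of cyclic subgroups of G / G', Z
  and Z / G' into numbers of components, and evaluating the formula for the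
  regular character at 1 shows that the dimensions add up to the order of G
  ([card_regular_sum]). *)

(** * Elements of given order and cyclic subgroups *)

Definition elts_of_order (L : finGroupType) (A : {set L}) d := [set u in A | #[u] == d].

Lemma card_expg_eq1 (L : finGroupType) (A : {set L}) d : 0 < d ->
  #|[set u in A | u ^+ d == 1]|
    = \sum_(e <- divisors d) #|elts_of_order A e|.
Proof.
move=> d_gt0; rewrite -sum1dep_card.
rewrite (eq_bigl (fun u => (u \in A) && (#[u] \in divisors d))); last first.
  by move=> u; rewrite -dvdn_divisors // order_dvdn.
under [RHS]eq_bigr => e _ do rewrite -sum1dep_card big_mkcond.
rewrite exchange_big /= big_mkcond /=; apply: eq_bigr => u _.
case: (u \in A) => /=; last by rewrite big1.
rewrite -big_mkcond sum1_count -(eq_count (a1 := pred1 #[u])); last first.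
  by move=> e /=; rewrite eq_sym.
by rewrite count_uniq_mem ?divisors_uniq //; case: (_ \in _).
Qed.

(** By induction over the divisors of d: the solutions of u ^ d = 1 are the
elements whose order divides d. *)
Lemma eq_card_elts_of_order (L1 L2 : finGroupType) (A : {set L1}) (B : {set L2}) :
    (forall d, #|[set u in A | u ^+ d == 1]| = #|[set v in B | v ^+ d == 1]|) ->
  forall d, 0 < d -> #|elts_of_order A d| = #|elts_of_order B d|.
Proof.
move=> E d; elim/ltn_ind: d => d IH d_gt0; have := E d.
rewrite !card_expg_eq1 //.
rewrite (bigD1_seq d) ?divisors_uniq ?divisors_id //.
rewrite [in RHS](bigD1_seq d) ?divisors_uniq ?divisors_id //=.
set s1 := (\sum_(_ <- _ | _) _); set s2 := (\sum_(_ <- _ | _) _).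
suffices -> : s1 = s2 by move/addIn.
rewrite /s1 /s2 big_seq_cond [RHS]big_seq_cond; apply: eq_bigr => e /andP[].
rewrite -dvdn_divisors // => de ne; apply: IH; last exact: dvdn_gt0 de.
by rewrite ltn_neqAle ne dvdn_leq.
Qed.

(** Each cyclic group of order d has totient d generators. *)
Lemma card_order_cycle (L : finGroupType) (A : {set L}) d :
    (forall u v, u \in A -> <[u]> = <[v]> -> v \in A) ->
  #|elts_of_order A d| = (#|[set <[u]> | u in elts_of_order A d]| * totient d)%N.
Proof.
move=> clA; rewrite -[LHS]sum1_card (partition_big_imset (fun u => <[u]>)) /=.
rewrite -sum_nat_const; apply: eq_bigr => _ /imsetP[u /setIdP[Au /eqP du] ->].
rewrite sum1dep_card -du totient_gen; apply: eq_card => v.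
rewrite !inE /generator [X in _ && X]eq_sym.
have [E | //] := eqVneq <[u]> <[v]>; last by rewrite andbF.
by rewrite (clA u) // !orderE E eqxx.
Qed.

Lemma num_cyclic_totient (gT : finGroupType) (H : {group gT}) d :
  (num_cyclic_subgroups H d * totient d)%N = #|elts_of_order H d|.
Proof.
rewrite card_order_cycle => [|u v Hu E]; last by rewrite -cycle_subG -E cycle_subG.
congr (_ * _)%N; rewrite /num_cyclic_subgroups -(card_imset _ (@group_inj gT)).
apply: eq_card => K; apply/imsetP/imsetP => [[M + ->] | [u /setIdP[Hu du] ->]].
  rewrite !inE => /and3P[sMH /cyclicP[u Mu] cM]; exists u; last exact: Mu.
  by rewrite inE -cycle_subG -Mu sMH orderE -Mu.
by exists <[u]>%G; rewrite // !inE cycle_subG Hu cycle_cyclic -orderE du.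
Qed.

(** The index type is the one that labels the copies of a summand in the
decomposition, so that components can be attached to the cyclic subgroups of
A. *)
Lemma cyclic_reps (L : finGroupType) (A : {set L}) a d :
    (forall u v, u \in A -> <[u]> = <[v]> -> v \in A) -> 0 < d ->
    #|elts_of_order A d| = (a * totient d)%N ->
  exists rep : 'I_a -> L,
    (forall k, rep k \in A /\ #[rep k] = d) /\
    (forall u, u \in A -> #[u] = d -> exists k, <[u]> = <[rep k]>).
Proof.
move=> clA d_gt0; rewrite card_order_cycle // => /eqP.
rewrite eqn_pmul2r ?totient_gt0 // => /eqP ca.
set S := (imset _ _) in ca.
have ex (k : 'I_a) :
    exists u, (u \in elts_of_order A d) && (enum_val (cast_ord (esym ca) k) == <[u]>).
  have /imsetP[u Au Eu] := enum_valP (cast_ord (esym ca) k).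
  by exists u; rewrite Au Eu eqxx.
exists (fun k => xchoose (ex k)); split=> [k | u Au du].
  by have /andP[/setIdP[-> /eqP->] _] := xchooseP (ex k).
have Su : <[u]> \in S by apply: imset_f; rewrite inE Au du eqxx.
exists (cast_ord ca (enum_rank_in Su <[u]>)).
have /andP[_ /eqP <-] := xchooseP (ex (cast_ord ca (enum_rank_in Su <[u]>))).
by rewrite cast_ordK enum_rankK_in.
Qed.

Lemma sum_card_elts_of_order (L : finGroupType) (S : {set L}) (s : seq nat) :
  uniq s -> (forall u, u \in S -> #[u]%g \in s) ->
  (\sum_(d <- s) #|elts_of_order S d| = #|S|)%N.
Proof.
move=> uniq_s inS; rewrite -[RHS]sum1_card.
under eq_bigr => d _ do rewrite -sum1dep_card big_mkcondr.
rewrite exchange_big; apply: eq_bigr => u Su /=.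
rewrite -big_mkcond sum1_count (eq_count (a2 := pred1 #[u]%g)).
  by rewrite count_uniq_mem // inS.
by move=> e /=; rewrite eq_sym.
Qed.

Lemma elts_of_order_dvd_exponent (gT : finGroupType) (H : {group gT}) d :
  elts_of_order H d != set0 -> (d %| exponent H)%N.
Proof. by case/set0Pn=> x /setIdP[Hx /eqP <-]; apply: dvdn_exponent. Qed.

Local Open Scope ring_scope.

(** * Linear characters trivial on a normal subgroup *)

(** These characters are inflated from the abelian group H / N, where they add
up to the regular character. *)
Lemma sum_irr_ker (gT : finGroupType) (H N : {group gT}) y :
  N <| H -> (H^`(1) \subset N)%g -> y \in H ->
  \sum_(i : Iirr H | N \subset cfker 'chi_i) 'chi_i y = (#|H : N| * (y \in N))%:R.
Proof.
move=> nNH sH'N Hy; rewrite (reindex _ (mod_Iirr_bij nNH)) /=.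
have Ny : y \in 'N(N) by rewrite (subsetP (normal_norm nNH)).
rewrite (eq_bigl predT) => [|i]; last by rewrite inE mod_IirrE // cfker_mod.
have /char_abelianP abHN : abelian (H / N)%g by rewrite sub_der1_abelian.
have := congr1 (fun phi : 'CF(H / N) => phi (coset N y)) (cfReg_sum (H / N)).
rewrite /= cfRegE sum_cfunE card_quotient ?normal_norm //.
have -> : (coset N y == 1%g) = (y \in N).
  by apply/eqP/idP => [/coset_idr->// | /coset_id].
rewrite mulrnA => ->; apply: eq_bigr => i _.
by rewrite mod_IirrE // cfModE // cfunE lin_char1 // mul1r.
Qed.

(** Translating the sum by h multiplies it by f h. *)
Lemma sum_multiplicative_eq0 (gT : finGroupType) (H : {group gT}) (f : gT -> algC) h :
  {in H &, {morph f : x y / (x * y)%g >-> x * y}} -> h \in H -> f h != 1 ->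
  \sum_(x in H) f x = 0.
Proof.
move=> fM Hh; rewrite -subr_eq0 => nz; apply: (mulfI nz); rewrite mulr0 mulrBl mul1r.
rewrite mulr_sumr [X in _ - X](reindex_astabs 'R h) /=; last first.
  by apply/astabsP=> x; rewrite groupMr.
by rewrite -sumrB big1 // => x Hx; rewrite fM // mulrC subrr.
Qed.

Lemma card_coset_preim (gT : finGroupType) (H N : {group gT}) (P : pred (coset_of N)) :
  N <| H ->
  #|[set x in H | P (coset N x)]| = (#|N| * #|[set y in (H / N)%g | P y]|)%N.
Proof.
move=> nNH; have nN := subsetP (normal_norm nNH).
rewrite -!sum1dep_card (partition_big (coset N) (fun y => (y \in (H / N)%g) && P y)) /=.
  rewrite big_distrr /=; apply: eq_bigr => _ /andP[/morphimP[z Nz Hz ->] Pz].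
  rewrite muln1 sum1dep_card -(card_rcoset N z); apply: eq_card => x.
  rewrite inE; apply/idP/idP => [/andP[/andP[Hx _] /eqP Ez] | zx].
    by apply/rcoset_kercosetP => //; exact: nN.
  have Hx : x \in H.
    have [n Nn ->] := rcosetP zx; apply: groupM => //.
    exact: (subsetP (normal_sub nNH)).
  have /rcoset_kercosetP E := zx.
  by rewrite E ?nN // Hx Pz eqxx.
by move=> x /andP[Hx Px]; rewrite Px mem_quotient.
Qed.

(** The linear characters of H, carried by a finite group L in order to speak of
the order and of the cyclic subgroup of a character. *)
Definition is_dual_group (gT : finGroupType) (H : {group gT}) (L : finGroupType)
    (cF : L -> 'CF(H)) :=
  [/\ injective cF, forall u, cF u \is a linear_char,
      forall phi, phi \is a linear_char -> exists u, phi = cF u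
    & [/\ cF 1%g = 1, forall k u, cF (u ^+ k)%g = cF u ^+ k & forall u, #[u]%g = #[cF u]%CF]].

Lemma exists_dual_group (gT : finGroupType) (H : {group gT}) :
  exists L : finGroupType, exists cF : L -> 'CF(H), is_dual_group cF.
Proof.
have [L [cF [injF _ linF surF] [F1 _ FX _ FO]]] := lin_char_group H.
by exists L, cF; split=> //; split=> // k u; rewrite FX.
Qed.

Section DualGroup.

Variables (gT : finGroupType) (H : {group gT}) (L : finGroupType) (cF : L -> 'CF(H)).
Hypothesis dualL : is_dual_group cF.

Lemma sum_dual_ker (N : {group gT}) y :
  N <| H -> (H^`(1) \subset N)%g -> y \in H ->
  \sum_(u | N \subset cfker (cF u)) cF u y = (#|H : N| * (y \in N))%:R.
Proof.
move=> nNH sH'N Hy; rewrite -sum_irr_ker //.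
have [injF linF surF _] := dualL.
have chiK u : 'chi_(cfIirr (cF u)) = cF u by rewrite cfIirrE ?lin_char_irr.
rewrite (reindex (fun u => cfIirr (cF u))) /=; last first.
  exists (fun i => odflt 1%g [pick u | cF u == 'chi_i]) => [u _ | i].
    case: pickP => [v /eqP | /(_ u)]; rewrite chiK ?eqxx //; exact: injF.
  rewrite inE => sNK; case: pickP => [v /eqP cv | no] /=.
    by apply: irr_inj; rewrite chiK.
  have [|u Eu] := surF 'chi_i; first by rewrite lin_irr_der1 (subset_trans sH'N).
  by have:= no u; rewrite Eu eqxx.
by apply: eq_big => u; rewrite chiK.
Qed.

Lemma sum_dual_exp u : \sum_(x in H) cF u x = (#|H| * (u == 1%g))%:R.
Proof.
have [injF linF surF [F1 FX _]] := dualL.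
have [-> | nt_u] := eqVneq u 1%g.
  rewrite F1 muln1; under eq_bigr => x Hx do rewrite cfun1E Hx.
  by rewrite sumr_const.
have [/forallP E | ] := boolP [forall x, (x \in H) ==> (cF u x == 1)].
  case/eqP: nt_u; apply: injF; rewrite F1; apply/cfun_inP=> x Hx.
  by rewrite cfun1E Hx; apply/eqP; exact: (implyP (E x)).
rewrite negb_forall => /existsP[h]; rewrite negb_imply => /andP[Hh].
rewrite muln0 => ne1.
by apply: sum_multiplicative_eq0 Hh ne1; exact: lin_charM.
Qed.

(** Both sides come from the sum of u x ^ d over all x in H and all u trivial
on N. Summing over x first selects the u with u ^ d = 1, summing over u first
selects the x with x ^ d in N. *)
Lemma card_dual_exp (N : {group gT}) d : N <| H -> (H^`(1) \subset N)%g ->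
  #|[set u | (N \subset cfker (cF u)) && (u ^+ d == 1)%g]|
    = #|[set y in (H / N)%g | (y ^+ d == 1)%g]|.
Proof.
move=> nNH sH'N; have [injF linF surF [F1 FX _]] := dualL.
have nN := subsetP (normal_norm nNH).
have inK x : x \in H -> (x ^+ d \in N)%g = (coset N x ^+ d == 1)%g.
  move=> Hx; rewrite -morphX ?nN //.
  by apply/idP/eqP => [/coset_id // | /coset_idr]; apply; rewrite nN ?groupX.
have eqC : \sum_(u | N \subset cfker (cF u)) \sum_(x in H) cF (u ^+ d)%g x
    = \sum_(x in H) (#|H : N| * (x ^+ d \in N)%g)%:R.
  rewrite exchange_big; apply: eq_bigr => x Hx /=.
  rewrite -sum_dual_ker ?groupX //; apply: eq_bigr => u _.
  by rewrite FX lin_charX // exp_cfunE.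
apply/eqP; rewrite -(eqn_pmul2r (cardG_gt0 H)) -(eqr_nat algC); apply/eqP.
transitivity (\sum_(u | N \subset cfker (cF u)) \sum_(x in H) cF (u ^+ d)%g x).
  under [RHS]eq_bigr => u _ do rewrite sum_dual_exp.
  rewrite -natr_sum -big_distrr /= mulnC; congr (_ * _)%:R.
  by rewrite -sum1dep_card big_mkcondr; apply: eq_bigr => u _; case: eqP.
rewrite eqC -natr_sum -big_distrr /= -(Lagrange (normal_sub nNH)).
congr _%:R; rewrite mulnA [RHS]mulnC; congr (_ * _)%N.
rewrite mulnC -(card_coset_preim (fun y => y ^+ d == 1)%g) //.
rewrite -sum1dep_card big_mkcondr; apply: eq_bigr => x Hx.
by rewrite inK //; case: eqP.
Qed.

Definition dual_ker (N : {set gT}) := [set u | N \subset cfker (cF u)].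

Lemma card_dual_order (N : {group gT}) d :
  N <| H -> H^`(1)%g \subset N -> (0 < d)%N ->
  #|elts_of_order (dual_ker N) d| = #|elts_of_order (H / N)%g d|.
Proof.
move=> nNH sH'N; apply: eq_card_elts_of_order => k.
rewrite -(card_dual_exp k nNH sH'N).
by apply: eq_card => u; rewrite !inE.
Qed.

Lemma card_order_quotient1 d : (0 < d)%N -> #|elts_of_order (H / 1)%g d| = #|elts_of_order H d|.
Proof.
apply: eq_card_elts_of_order => k; have := card_coset_preim (fun y => y ^+ k == 1)%g (normal1 H).
rewrite cards1 mul1n => <-; apply: eq_card => x; rewrite !inE.
have Nx : x \in 'N(1)%g by rewrite norm1 inE.
rewrite -morphX //; congr (_ && _); apply/eqP/eqP => [| ->]; last exact: morph1.
by move/coset_idr=> /(_ _)/set1P->; rewrite ?norm1 ?inE.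
Qed.

Lemma dual_ker_cycle N u v : u \in dual_ker N -> <[u]>%g = <[v]>%g -> v \in dual_ker N.
Proof.
have [injF linF surF [F1 FX _]] := dualL.
rewrite !inE => /subsetP sNu E; have /cycleP[k ->] : v \in <[u]>%g by rewrite E cycle_id.
apply/subsetP=> x /sNu; rewrite !cfkerEchar ?lin_charW // !inE !lin_char1 //.
by case/andP=> Hx /eqP ux; rewrite Hx FX exp_cfunE // ux expr1n eqxx.
Qed.

(** If u = v ^ k with k prime to the order of v, the automorphism that raises
the roots of unity of that order to the power k maps the values of v to those
of u. *)
Lemma galois_conjugate u v : <[u]>%g = <[v]>%g ->
  exists s : {rmorphism algC -> algC}, forall x, s (cF v x) = cF u x.
Proof.
have [injF linF surF [F1 FX FO]] := dualL.
move=> E; have [k co_k Du] : exists2 k, coprime k #[v]%g & u = (v ^+ k)%g.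
  have /cycleP[k Du] : u \in <[v]>%g by rewrite -E cycle_id.
  by exists k => //; rewrite coprime_sym -generator_coprime /generator -Du E.
have [s sP] := Qn_aut_exists co_k; exists s => x.
have [Hx | nHx] := boolP (x \in H); last by rewrite !cfun0 ?rmorph0.
by rewrite sP ?Du ?FX ?exp_cfunE // -exp_cfunE // -FX expg_order F1 cfun1E Hx.
Qed.

End DualGroup.

(** * Commutators in VZ-groups *)

(** Otherwise g and g * x are not conjugate, and the orthogonality of their
columns fails: nonlinear characters contribute 0 to the sum, and each of the
linear ones, which are constant on the coset g G', contributes 1. *)
Lemma vz_commutator (gT : finGroupType) (G : {group gT}) g x :
    VZ_group G -> g \in G :\: 'Z(G) -> x \in G^`(1)%g ->
  exists2 h, h \in G & [~ g, h]%g = x.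
Proof.
move=> vzG Zg G'x; have /setDP[Gg _] := Zg.
have Gx : x \in G by apply: subsetP G'x; exact: der_sub.
have [/imsetP[h Gh E]|no] := boolP ((g * x)%g \in g ^: G).
  by exists h; rewrite // commgEl -E mulKg.
have := second_orthogonality_relation g (groupM Gg Gx).
have -> : (g \in (g * x) ^: G) = false.
  apply: contraNF no => /imsetP[h Gh E]; apply/imsetP; exists h^-1%g; rewrite ?groupV //.
  by rewrite {2}E conjgK.
rewrite (bigID (fun i : Iirr G => 'chi_i \is a linear_char)) /= mulr0n.
rewrite [X in _ + X]big1 ?addr0 => [|i nl]; last by rewrite vzG ?mul0r.
rewrite (eq_bigr (fun=> 1)) => [/eqP|i li].
  rewrite sumr_const -[0]/(0%:R) eqr_nat card_lin_irr => /eqP E.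
  by have:= indexg_gt0 G G^`(1)%g; rewrite E.
have -> : 'chi_i (g * x)%g = 'chi_i g.
  by rewrite cfkerMr // (subsetP (lin_char_der1 li)).
by rewrite -normCK normC_lin_char // expr1n.
Qed.

(** If x in G' were not central, x and x * x^-1 = 1 would be conjugate. *)
Lemma vz_der_center (gT : finGroupType) (G : {group gT}) :
  VZ_group G -> (G^`(1) \subset 'Z(G))%g.
Proof.
move=> vzG; apply/subsetP=> x G'x; apply: contraT => Zx.
have Gx : x \in G by apply: subsetP G'x; exact: der_sub.
have [||h Gh E] := @vz_commutator _ G x x^-1%g vzG; rewrite ?groupV //.
  by rewrite inE Zx.
have : (x ^ h == 1)%g by rewrite -(mulKVg x (x ^ h)%g) -commgEl E mulgV.
by rewrite conjg_eq1 => /eqP x1; rewrite x1 group1 in Zx.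
Qed.

(** * The commutator pairing of a central character *)

Lemma sum_mem_card (T : finType) (A S : {set T}) :
  A \subset S -> (\sum_(x in S) (x \in A) = #|A|)%N.
Proof.
move=> sAS; rewrite -sum1_card [RHS]big_mkcond [LHS]big_mkcond; apply: eq_bigr => x _.
by have [Ax | _] := boolP (x \in A); [rewrite (subsetP sAS) | case: ifP].
Qed.

Section Pairing.

Variables (gT : finGroupType) (G : {group gT}) (lam : 'CF('Z(G))).
Hypotheses (sG'Z : (G^`(1) \subset 'Z(G))%g) (linlam : lam \is a linear_char).
Hypothesis nondeg : forall g, g \in G :\: 'Z(G) -> exists2 h, h \in G & lam [~ g, h]%g != 1.
Local Notation Z := 'Z(G)%g.

Definition pairing g h := lam [~ g, h]%g.
Local Notation B := pairing.

Let commZ g h : g \in G -> h \in G -> [~ g, h]%g \in Z.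
Proof. by move=> Gg Gh; rewrite (subsetP sG'Z) // mem_commg. Qed.

Let conjZ z g : z \in Z -> g \in G -> (z ^ g = z)%g.
Proof. by move=> /centerP[_ cz] Gg; rewrite conjgE cz // mulKg. Qed.

Lemma pairingMl x y z : x \in G -> y \in G -> z \in G -> B (x * y)%g z = B x z * B y z.
Proof. by move=> Gx Gy Gz; rewrite /B commMgJ conjZ ?commZ // lin_charM ?commZ. Qed.

Lemma pairingMr x y z : x \in G -> y \in G -> z \in G -> B z (x * y)%g = B z x * B z y.
Proof. by move=> Gx Gy Gz; rewrite /B commgMJ conjZ ?commZ // lin_charM ?commZ // mulrC. Qed.

Lemma pairing_eq1C x y : x \in G -> y \in G -> (B x y == 1) = (B y x == 1).
Proof. by move=> Gx Gy; rewrite /B -invgR lin_charV ?commZ // invr_eq1. Qed.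

Lemma pairing1r x : B x 1%g = 1. Proof. by rewrite /B commg1 lin_char1. Qed.

Lemma pairingXr x y k : x \in G -> y \in G -> B x (y ^+ k)%g = B x y ^+ k.
Proof.
move=> Gx Gy; elim: k => [|k IH]; first by rewrite expr0 expg0 pairing1r.
by rewrite expgS pairingMr ?groupX // IH exprS.
Qed.

Lemma pairing_alt x : B x x = 1. Proof. by rewrite /B commgg lin_char1. Qed.

Lemma pairing_centerl z x : z \in Z -> x \in G -> B z x = 1.
Proof.
by move=> /centerP[_ cz] Gx; rewrite /B; have /commgP/eqP-> := cz x Gx; apply: lin_char1.
Qed.

Definition perp (A : {set gT}) := [set g in G | [forall a in A, B a g == 1]].

Lemma perpP (A : {set gT}) g : reflect (g \in G /\ forall a, a \in A -> B a g = 1) (g \in perp A).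
Proof.
rewrite inE; apply: (iffP andP) => -[Gg H]; split=> //.
  by move=> a Aa; exact/eqP/(forall_inP H).
by apply/forall_inP=> a Aa; rewrite H.
Qed.

Lemma perp_group_set (A : {set gT}) : A \subset G -> group_set (perp A).
Proof.
move=> /subsetP sAG; apply/group_setP; split=> [|x y].
  by apply/perpP; split=> // a _; rewrite pairing1r.
move=> /perpP[Gx Hx] /perpP[Gy Hy]; apply/perpP; split=> [|a Aa]; first exact: groupM.
by rewrite pairingMr ?(Hx a Aa) ?(Hy a Aa) ?mulr1 //; exact: sAG.
Qed.

(** The sum of the pairing over A x G, computed in both orders: a fixed g
contributes only if it is orthogonal to A, a fixed a contributes only if it is
central. *)
Lemma card_perp (A : {group gT}) : Z \subset A -> A \subset G ->
  (#|A| * #|perp A| = #|Z| * #|G|)%N.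
Proof.
move=> sZA sAG; have sAG' := subsetP sAG.
have E1 g : g \in G -> \sum_(a in A) B a g = (#|A| * (g \in perp A))%:R.
  move=> Gg; case: (boolP (g \in perp A)) => [/perpP[_ Hg] | /negP no].
    by rewrite muln1 (eq_bigr (fun=> 1)) // sumr_const.
  have [h Ah ne] : exists2 a, a \in A & B a g != 1.
    apply/exists_inP; apply: contra_notT no => /exists_inPn H.
    by apply/perpP; split=> // a /H; rewrite negbK => /eqP.
  rewrite muln0; apply: (sum_multiplicative_eq0 (f := B^~ g)) Ah ne => x y Ax Ay.
  by apply: pairingMl; rewrite // sAG'.
have E2 a : a \in G -> \sum_(g in G) B a g = (#|G| * (a \in Z))%:R.
  move=> Ga; case: (boolP (a \in Z)) => [Za | nZa].
    rewrite muln1 (eq_bigr (fun=> 1)) ?sumr_const // => g Gg.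
    by rewrite pairing_centerl.
  have [|h Gh ne] := @nondeg a; first by rewrite inE nZa.
  rewrite muln0; apply: (sum_multiplicative_eq0 (f := B a)) Gh ne => x y Gx Gy.
  by rewrite pairingMr.
apply/eqP; rewrite -(eqr_nat algC); apply/eqP.
transitivity (\sum_(g in G) \sum_(a in A) B a g).
  under eq_bigr => g Gg do rewrite E1 //.
  rewrite -natr_sum -big_distrr /=; congr (_ * _)%:R.
  have sPG : perp A \subset G by apply/subsetP=> g /perpP[].
  by rewrite sum_mem_card.
rewrite exchange_big; under eq_bigr => a Aa do rewrite (E2 _ (sAG' _ Aa)).
rewrite -natr_sum -big_distrr /= mulnC; congr (_ * _)%:R.
by rewrite sum_mem_card.
Qed.

End Pairing.

(** * A maximal isotropic subgroup with an extension of the same order *)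

(** The elements of order dividing p form a subgroup of order at least p ^ 2. *)
Lemma noncyclic_order_p (gT : finGroupType) p (Q : {group gT}) :
    prime p -> p.-group Q -> abelian Q -> ~~ cyclic Q ->
  exists x y : gT, [/\ x \in Q, y \in Q, #[x]%g = p, #[y]%g = p & y \notin <[x]>%g].
Proof.
move=> pr_p pQ abQ; rewrite abelian_rank1_cyclic // (rank_pgroup pQ) -ltnNge.
rewrite p_rank_abelian // => ltr.
have abO := Ohm1_abelem pQ abQ; have /subsetP sOQ := Ohm_sub 1 Q.
have cO : (p ^ 2 <= #|'Ohm_1(Q)%g|)%N.
  have /andP[pO _] := abO.
  by rewrite (card_pgroup pO) leq_pexp2l ?prime_gt0.
have p_lt : (p < #|'Ohm_1(Q)%g|)%N.
  by apply: leq_trans cO; rewrite ltn_Pmulr ?prime_gt1 ?prime_gt0.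
have [x Ox ntx] : exists2 x, x \in 'Ohm_1(Q)%g & x != 1%g.
  by apply/trivgPn; rewrite trivg_card1 gtn_eqF // (ltn_trans (prime_gt1 pr_p)).
have ox := abelem_order_p abO Ox ntx.
have /subsetPn[y Oy nxy] : ~~ ('Ohm_1(Q)%g \subset <[x]>%g).
  by apply: contraL p_lt => /subset_leq_card; rewrite -leqNgt -orderE ox.
exists x, y; rewrite !sOQ // ox (abelem_order_p abO Oy) //.
by apply: contraNneq nxy => ->; exact: group1.
Qed.

Section Lagrangian.

Variables (p : nat) (gT : finGroupType) (G : {group gT}) (lam : 'CF('Z(G))).
Hypotheses (sG'Z : (G^`(1) \subset 'Z(G))%g) (linlam : lam \is a linear_char).
Hypothesis nondeg : forall g, g \in G :\: 'Z(G) -> exists2 h, h \in G & lam [~ g, h]%g != 1.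
Local Notation Z := 'Z(G)%g.
Local Notation B := (pairing lam).

(** If C, the orthogonal of A, is generated by A and one element g, then C is
isotropic because the pairing is alternating. So C is contained in its own
orthogonal, which has the order of A. *)
Lemma noncyclic_perp_quotient (A : {group gT}) :
  Z \subset A -> A \subset G -> A \subset perp lam A ->
  cyclic (perp lam A / A)%g -> perp lam A = A.
Proof.
move=> sZA sAG sAP.
pose C := Group (perp_group_set sG'Z linlam sAG).
rewrite -[perp lam A]/(gval C) in sAP * => /cyclicP[gb Egb].
have sCG : C \subset G by apply/subsetP=> g /perpP[].
have nAG : A <| G by apply: sub_der1_normal => //; exact: subset_trans sZA.
have nAC : C \subset 'N(A) := subset_trans sCG (normal_norm nAG).
have /morphimP[g Ng Cg Dg] : gb \in (C / A)%g by rewrite Egb cycle_id.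
have Gg := subsetP sCG _ Cg.
pose CC := Group (perp_group_set sG'Z linlam sCG).
have sACC : A \subset CC.
  apply/subsetP=> a Aa; apply/perpP; split=> [|c /perpP[Gc Hc]]; first exact: (subsetP sAG).
  by apply/eqP; rewrite (pairing_eq1C sG'Z linlam) ?Hc ?eqxx //; exact: (subsetP sAG).
have gen c : c \in C -> c \in (A * <[g]>)%g.
  move=> Cc; have : coset A c \in (C / A)%g by apply: mem_quotient.
  rewrite Egb Dg => /cycleP[i Ei].
  have /rcosetP[a Aa ->] : c \in (A :* (g ^+ i))%g.
    by apply/rcoset_kercosetP; rewrite ?groupX ?(subsetP nAC) // morphX.
  by rewrite mem_mulg ?mem_cycle.
have gCC : g \in CC.
  apply/perpP; split=> // c /gen /mulsgP[a _ Aa /cycleP[i ->] ->].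
  have Ga := subsetP sAG a Aa; have /perpP[_ /(_ a Aa) Bag] := Cg.
  rewrite (pairingMl sG'Z) ?groupX // Bag mul1r; apply/eqP.
  by rewrite (pairing_eq1C sG'Z) ?groupX // (pairingXr sG'Z) // pairing_alt // expr1n.
have sCCC : C \subset CC.
  by apply/subsetP=> c /gen; apply: subsetP; rewrite mul_subG ?cycle_subG.
apply/eqP; rewrite eq_sym eqEcard sAP /=.
have := card_perp sG'Z linlam nondeg (subset_trans sZA sAP) sCG.
rewrite -(card_perp sG'Z linlam nondeg sZA sAG) mulnC => /eqP.
rewrite eqn_pmul2r ?cardG_gt0 // => /eqP <-.
exact: subset_leq_card.
Qed.

(** The last condition says that mu (x ^ p) is the p-th power of a d-th root of
unity, so that x can be sent to such a root by an extension of mu. The x with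
x ^ p in A form a subgroup of the orthogonal C of A, with the map psi sending x
to the (d / p)-th power of mu (x ^ p). Since p is odd and G has class at most
2, psi is multiplicative; its values are p-th roots of unity. As C / A is not
cyclic, it contains two independent elements of order p, and some combination
of them is in the kernel of psi. *)
Lemma exists_extension_element (A : {group gT}) (mu : 'CF(A)) d :
    prime p -> odd p -> (p.-group G)%g -> Z \subset A -> A \subset G ->
    A \subset perp lam A -> mu \is a linear_char -> {in Z, mu =1 lam} ->
    (p %| d)%N -> {in A, forall a, mu a ^+ d = 1} -> perp lam A != A ->
  exists x, [/\ x \in perp lam A, x \notin A, (x ^+ p)%g \in A
               & mu (x ^+ p)%g ^+ (d %/ p) = 1].
Proof.
move=> pr_p odd_p pG sZA sAG sAP linmu muZ pd mud neC.
pose C := Group (perp_group_set sG'Z linlam sAG).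
have sAC : A \subset C by [].
have sCG : C \subset G by apply/subsetP=> g /perpP[].
have nAG : A <| G by apply: sub_der1_normal => //; exact: subset_trans sZA.
have nAC : C \subset 'N(A) := subset_trans sCG (normal_norm nAG).
have abCA : abelian (C / A)%g.
  by rewrite sub_der1_abelian // (subset_trans (dergS 1 sCG)) // (subset_trans sG'Z).
have ncyc : ~~ cyclic (C / A)%g.
  by apply: contra neC => cyc; apply/eqP/noncyclic_perp_quotient.
have pCA : (p.-group (C / A))%g by rewrite quotient_pgroup // (pgroupS sCG).
have [xb [yb [/morphimP[x Nx Cx ->] /morphimP[y Ny Cy ->] ox oy nyx]]] :=
  noncyclic_order_p pr_p pCA abCA ncyc.
have inA z : z \in 'N(A) -> #[coset A z]%g = p -> (z ^+ p)%g \in A.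
  by move=> Nz oz; apply: coset_idr; rewrite ?groupX // morphX //= -oz expg_order.
have psiM z w : z \in C -> w \in C -> (z ^+ p)%g \in A -> (w ^+ p)%g \in A ->
    ((z * w) ^+ p)%g \in A /\ mu ((z * w) ^+ p)%g = mu (z ^+ p)%g * mu (w ^+ p)%g.
  move=> Cz Cw Az Aw; have Gz := subsetP sCG z Cz; have Gw := subsetP sCG w Cw.
  have Zc : [~ w, z]%g \in Z by rewrite (subsetP sG'Z) // mem_commg.
  have cZ u : u \in G -> commute u [~ w, z]%g.
    by have /centerP[_ cz] := Zc; move=> /cz.
  rewrite expMg_Rmul; [|exact: cZ|exact: cZ].
  have Ac : ([~ w, z] ^+ 'C(p, 2))%g \in A by rewrite groupX // (subsetP sZA).
  split; first by rewrite !groupM.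
  rewrite !lin_charM ?groupM // [X in _ * X](_ : _ = 1) ?mulr1 //.
  rewrite muZ ?groupX // lin_charX // -/(B w z).
  (* The exponent of the commutator is a multiple of p as p is odd, and the
     p-th power of B w z is B w (z ^ p) = 1. *)
  have p2 : (2 < p)%N by case: (p) pr_p odd_p => [|[|[|]]].
  have /dvdnP[k ->] : (p %| 'C(p, 2))%N by rewrite prime_dvd_bin.
  rewrite mulnC exprM -(pairingXr sG'Z) //.
  have /perpP[_ /(_ _ Az)/eqP] := Cw.
  by rewrite (pairing_eq1C sG'Z) ?groupX // => /eqP->; rewrite expr1n.
have Ax := inA x Nx ox; have Ay := inA y Ny oy.
have nAx : x \notin A.
  by apply: contraTN pr_p => /coset_id cx; move: ox; rewrite /= cx order1 => <-.
pose psi z := mu (z ^+ p)%g ^+ (d %/ p).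
have psip z : (z ^+ p)%g \in A -> psi z ^+ p = 1.
  by move=> Az; rewrite /psi -exprM divnK // mud.
have [psi1 | psin1] := eqVneq (psi x) 1; first by exists x.
have [m prim_x dvd_m] := prim_order_exists (prime_gt0 pr_p) (psip x Ax).
have {dvd_m} mp : m = p.
  have /orP[/eqP m1 | /eqP //] := (primeP pr_p).2 m dvd_m.
  by case/eqP: psin1; rewrite -(prim_expr_order prim_x) m1 expr1.
rewrite {m}mp in prim_x.
(* Some power of x has psi equal to the inverse of psi y, as psi x is a
   primitive p-th root of unity. *)
have psiVy : (psi y)^-1 ^+ p = 1 by rewrite exprVn psip // invr1.
have [k Ek] := prim_rootP prim_x psiVy.
have Axk : ((x ^+ k) ^+ p)%g \in A by rewrite -expgM mulnC expgM groupX.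
have [||||Ayx muyx] := psiM y (x ^+ k)%g => //; first exact: (groupX (G := C)).
exists (y * x ^+ k)%g; split=> //.
- by apply: (groupM (G := C)); rewrite // groupX.
- apply: contra nyx => nyx; have Nxk : (x ^+ k)%g \in 'N(A) by rewrite groupX.
  have : (coset A y * coset A x ^+ k = 1)%g by rewrite -morphX // -morphM //= coset_id.
  by move/(canRL (mulgK _)) => E; rewrite /= E mul1g groupV mem_cycle.
rewrite muyx // exprMn -expgM mulnC expgM (lin_charX linmu k) //.
rewrite -[X in _ * X]exprM [(k * _)%N]mulnC exprM.
rewrite -/(psi x) -Ek -/(psi y) mulfV //.
apply/eqP=> y0; have /eqP := psip y Ay.
by rewrite y0 expr0n gtn_eqF ?prime_gt0 // eq_sym oner_eq0.
Qed.

(** The subgroup D is generated by A and x. It fixes mu since x is orthogonal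
to A, so mu extends to D, the index being prime. Any extension nu does,
because nu x ^ d = mu (x ^ p) ^ (d / p). *)
Lemma extend_linear_char (A : {group gT}) (mu : 'CF(A)) d x :
    prime p -> Z \subset A -> A \subset G ->
    mu \is a linear_char -> {in Z, mu =1 lam} ->
    (p %| d)%N -> {in A, forall a, mu a ^+ d = 1} ->
    x \in perp lam A -> x \notin A -> (x ^+ p)%g \in A -> mu (x ^+ p)%g ^+ (d %/ p) = 1 ->
  exists D : {group gT}, exists nu : 'CF(D),
    [/\ A \proper D, D \subset G, nu \is a linear_char, {in Z, nu =1 lam}
      & {in D, forall a, nu a ^+ d = 1}].
Proof.
move=> pr_p sZA sAG linmu muZ pd mud Cx nAx Axp muxp.
have [Gx _] := perpP _ _ _ Cx.
have nAG : A <| G by apply: sub_der1_normal => //; exact: subset_trans sZA.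
have Nx : x \in 'N(A) by rewrite (subsetP (normal_norm nAG)).
pose D := (A <*> <[x]>)%G; have sAD : A \subset D := joing_subl _ _.
have Dx : x \in D by rewrite (subsetP (joing_subr A <[x]>)) ?cycle_id.
have sDG : D \subset G by rewrite join_subG sAG cycle_subG.
have nAD : A <| D := normalS sAD sDG nAG.
have nCyc : <[x]>%g \subset 'N(A) by rewrite cycle_subG.
have iDA : #|D : A| = p.
  rewrite -card_quotient ?normal_norm // quotientYidl // quotient_cycle // -orderE.
  apply: nt_prime_order => //; last by apply: contraNneq nAx => /coset_idr->.
  by have := coset_id Axp; rewrite morphX.
have invmu : D \subset 'I[mu].
  rewrite join_subG sub_inertia // cycle_subG inE Nx; apply/eqP/cfun_inP=> a Aa.
  have Ga := subsetP sAG a Aa.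
  have Zax : [~ a, x^-1]%g \in Z by rewrite (subsetP sG'Z) // mem_commg ?groupV.
  rewrite cfConjgE // -(mulKVg a (a ^ x^-1)%g) -commgEl lin_charM //; last exact: (subsetP sZA).
  rewrite (muZ _ Zax) -[lam _]/(B a x^-1%g).
  have /perpP[_ ->] : x^-1%g \in perp lam A; rewrite ?mulr1 //.
  by apply: (groupVr (G := Group (perp_group_set sG'Z linlam sAG))).
have /irrP[s Ds] := lin_char_irr linmu; rewrite Ds in invmu.
have [t Dt] := prime_invariant_irr_extendible nAD iDA pr_p invmu.
have nuA : {in A, 'chi_t =1 mu} by move=> a Aa; rewrite Ds -Dt cfResE.
have linnu : 'chi_t \is a linear_char.
  by rewrite qualifE /= irr_char (nuA 1%g (group1 A)) lin_char1 ?eqxx.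
exists D, 'chi_t; split=> //.
- by rewrite properE sAD; apply: contra nAx => /subsetP->.
- by move=> z Zz; rewrite nuA ?muZ // (subsetP sZA).
move=> g; have -> : (g \in D) = (g \in A * <[x]>)%g by rewrite [gval D]norm_joinEr.
move=> /mulsgP[a _ Aa /cycleP[i ->] ->]; have Da := subsetP sAD a Aa.
rewrite lin_charM ?groupX // lin_charX // exprMn nuA // mud // mul1r.
by rewrite exprAC -[d](divnK pd) mulnC exprM -lin_charX // nuA // muxp expr1n.
Qed.

(** A is chosen maximal among the subgroups to which lam extends with values
that are d-th roots of unity. If it were not its own orthogonal,
[exists_extension_element] and [extend_linear_char] would give a larger one.
The formula for the orders is then [card_perp]. *)
Lemma exists_lagrangian d :
    prime p -> odd p -> (p.-group G)%g -> (p %| d)%N ->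
    {in Z, forall z, lam z ^+ d = 1} ->
  exists A : {group gT}, exists mu : 'CF(A),
    [/\ Z \subset A, A \subset G, mu \is a linear_char, {in Z, mu =1 lam}
     & {in A, forall a, mu a ^+ d = 1} /\ (#|A| * #|A| = #|Z| * #|G|)%N ].
Proof.
move=> pr_p odd_p pG pd lamd.
pose adm (A : {group gT}) := [&& Z \subset A, A \subset G
  & [exists t : Iirr A, ('chi_t \is a linear_char) &&
      ([forall z in Z, 'chi_t z == lam z] && [forall a in A, 'chi_t a ^+ d == 1])]].
have admP (A : {group gT}) (mu : 'CF(A)) : Z \subset A -> A \subset G ->
    mu \is a linear_char -> {in Z, mu =1 lam} -> {in A, forall a, mu a ^+ d = 1} -> adm A.
  move=> sZA sAG linmu muZ mud; apply/and3P; split=> //; apply/existsP.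
  have /irrP[s Ds] := lin_char_irr linmu; exists s; rewrite -Ds linmu /=.
  by apply/andP; split; apply/forall_inP=> a Aa; rewrite ?(muZ _ Aa) ?(mud _ Aa).
have [|A /maxgroupP[/and3P[sZA sAG /existsP[t admt]] maxA]] := @ex_maxgroup _ adm.
  by exists 'Z(G)%G; apply: (admP 'Z(G)%G lam); rewrite ?center_sub.
have /andP[lint /andP[/forall_inP tZ /forall_inP td]] := admt.
have {}tZ : {in Z, 'chi_t =1 lam} by move=> z /tZ/eqP.
have {}td : {in A, forall a, 'chi_t a ^+ d = 1} by move=> a /td/eqP.
exists A, 'chi_t; split=> //; split=> //.
have sAP : A \subset perp lam A.
  apply/subsetP=> a Aa; apply/perpP; split=> [|b Ab]; first exact: (subsetP sAG).
  have G'c : [~ b, a]%g \in A^`(1)%g by rewrite mem_commg.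
  rewrite /pairing -tZ; last by rewrite (subsetP sG'Z) // (subsetP (dergS 1 sAG)).
  by rewrite cfker1 ?lin_char1 // (subsetP (lin_char_der1 lint)).
rewrite -(card_perp sG'Z linlam nondeg sZA sAG).
have [-> // | neA] := eqVneq (perp lam A) A.
have [x [Cx nAx Axp mux]] := exists_extension_element pr_p odd_p pG sZA sAG sAP lint tZ pd td neA.
have [D [nu [/andP[sAD nDA] sDG linnu nuZ nud]]] :=
  extend_linear_char pr_p sZA sAG lint tZ pd td Cx nAx Axp mux.
case/negP: nDA; rewrite (maxA D) //.
by apply: admP nuZ nud => //; exact: subset_trans sAD.
Qed.

End Lagrangian.

(** * Dimensions over the rationals *)

(** An upper bound for the rational dimension, in a form that can be checked
on direct sums of algebras without choosing bases. *)
Definition embeds_dim (V : lmodType rat) (N : nat) :=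
  exists T : finType, #|T| = N /\
    exists phi : V -> {ffun T -> rat^o}, linear phi /\ injective phi.

Lemma linear_inj_surj (S T : finType) (h : {ffun S -> rat^o} -> {ffun T -> rat^o}) :
  #|S| = #|T| -> linear h -> injective h -> forall y, exists x, h x = y.
Proof.
move=> cST lh injh y.
pose hL := GRing.isLinear.Build _ _ _ _ h lh.
pose H : {linear _ -> _} := HB.pack h hL.
have kerH : lker (linfun H) == 0%VS.
  by apply/lker0P=> u v; rewrite !lfunE => /injh.
have [e eK] : exists e, forall v, H (e v) = v.
  exists ((linfun H)^-1)%VF => v.
  have imH : limg (linfun H) = fullv.
    apply/eqP; rewrite eqEdim subvf limg_dim_eq ?(eqP kerH) ?capv0 //.
    by rewrite !dimvf /= /dim /= cST.
  by rewrite -[H _]lfunE limg_lfunVK // imH memvf.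
by exists (e y); rewrite -[LHS]/(H (e y)).
Qed.

(** The composite of f with an embedding of V is an injective linear map between
spaces of the same finite dimension, hence onto. *)
Lemma embeds_dim_surj (S : finType) (V : lmodType rat)
    (f : {ffun S -> rat^o} -> V) :
  embeds_dim V #|S| -> linear f -> injective f -> bijective f.
Proof.
move=> [T [cT [phi [lphi iphi]]]] lf injf.
have surjf y : exists x, f x == y.
  have lin : linear (phi \o f) by move=> a u v /=; rewrite lf lphi.
  have [x xP] := linear_inj_surj (esym cT) lin (inj_comp iphi injf) (phi y).
  by exists x; apply/eqP/iphi.
exists (fun y => xchoose (surjf y)) => [x | y].
  by apply: injf; apply/eqP/(xchooseP (surjf _)).
by apply/eqP/(xchooseP (surjf _)).
Qed.

Lemma embeds_dim_prod (V W : lmodType rat) N M :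
  embeds_dim V N -> embeds_dim W M -> embeds_dim (V * W)%type (N + M).
Proof.
move=> [T [<- [f [lf jf]]]] [U [<- [g [lg jg]]]].
exists (T + U)%type; split; first by rewrite card_sum.
exists (fun v => [ffun i => match i with inl t => f v.1 t | inr u => g v.2 u end]).
split=> [a u v | u v /ffunP E].
  by apply/ffunP=> -[t | t]; rewrite !ffunE /= ?lf ?lg !ffunE.
case: u v E => [u1 u2] [v1 v2] E; congr (_, _).
  by apply/jf/ffunP=> t; have:= E (inl t); rewrite !ffunE.
by apply/jg/ffunP=> t; have:= E (inr t); rewrite !ffunE.
Qed.

Lemma embeds_dim_dsum (I : finType) (A : I -> algType rat) (N : I -> nat) :
  (forall i, embeds_dim (A i) (N i)) -> embeds_dim (dsum A) (\sum_i N i).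
Proof.
move=> /fin_all_exists[T HT].
have cT i := (HT i).1; have /fin_all_exists[f fP] := fun i => (HT i).2.
exists {i : I & T i}; split.
  by rewrite card_tagged sumnE big_map big_enum; apply: eq_bigr.
exists (fun v : dsum A => [ffun t => f (tag t) (v (tag t)) (tagged t)]).
split=> [a u v | u v /ffunP E].
  apply/ffunP=> -[i t]; rewrite !ffunE /=.
  by rewrite (fP i).1 !ffunE.
apply/ffunP=> i; apply: (fP i).2; apply/ffunP=> t.
by have:= E (Tagged T t); rewrite !ffunE.
Qed.

Lemma embeds_dim_mxalg (A : algType rat) n N :
  (0 < n)%N -> embeds_dim A N -> embeds_dim (mxalg n A) (n ^ 2 * N).
Proof.
case: n => // n _ [T [<- [f [lf jf]]]].
exists ('I_n.+1 * 'I_n.+1 * T)%type; split; first by rewrite !card_prod card_ord.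
exists (fun X : mxalg n.+1 A => [ffun t => f (X t.1.1 t.1.2) t.2]).
split=> [a u v | u v /ffunP E].
  by apply/ffunP=> t; rewrite !ffunE !mxE lf !ffunE.
apply/matrixP=> i j; apply/jf/ffunP=> t.
by have:= E (i, j, t); rewrite !ffunE.
Qed.

(** It is the minimal polynomial of zeta d. *)
Lemma Cyclotomic_irreducible d :
  (0 < d)%N -> irreducible_poly (map_poly intr 'Phi_d : {poly rat}).
Proof.
move=> d_gt0; have [nz rz] := Qzeta_root d_gt0.
apply/(subfx_irreducibleP rz nz) => q qz nzq.
have [r [Dr mon_r] /(_ q) Er] := minCpolyP (zeta d).
have sr : size r = size (map_poly intr 'Phi_d : {poly rat}).
  rewrite -(size_map_poly (@ratr algC)) -Dr (minCpoly_cyclotomic (zetaP d_gt0)).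
  by rewrite -(Cintr_Cyclotomic (zetaP d_gt0)) !size_map_inj_poly //; exact: intr_inj.
by rewrite -sr dvdp_leq // -Er.
Qed.

Lemma embeds_dim_Qzeta d : (0 < d)%N -> embeds_dim (Qzeta d) (totient d).
Proof.
move=> d_gt0; have [nz rz] := Qzeta_root d_gt0.
have [v2r lv [r2v K _]] := min_subfx_vect rz (Cyclotomic_irreducible d_gt0).
have sz : (size (map_poly intr 'Phi_d : {poly rat})).-1 = totient d.
  by rewrite size_map_inj_poly ?size_Cyclotomic //; exact: intr_inj.
exists 'I_(size (map_poly intr 'Phi_d : {poly rat})).-1; split.
  by rewrite card_ord.
exists (fun x => [ffun i => v2r x 0 i]); split=> [a u v | u v /ffunP E].
  by apply/ffunP=> i; rewrite !ffunE lv !mxE.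
by apply/(can_inj K)/rowP=> i; have:= E i; rewrite !ffunE.
Qed.

(** The embedding of the cyclotomic field in the complex numbers that sends
the adjoined root to zeta d. *)
Definition Qzeta_val d : Qzeta d -> algC :=
  @subfx_inj _ _ (@ratr algC) (zeta d) (map_poly intr 'Phi_d).

HB.instance Definition _ d := GRing.RMorphism.copy (@Qzeta_val d)
  (@subfx_inj _ _ (@ratr algC) (zeta d) (map_poly intr 'Phi_d)).

Lemma Qzeta_valZ d (d_gt0 : (0 < d)%N) a (x : Qzeta d) :
  Qzeta_val (a *: x) = ratr a * Qzeta_val x.
Proof. by have [nz rz] := Qzeta_root d_gt0; apply: subfx_injZ. Qed.

Lemma Qzeta_val_root d (d_gt0 : (0 < d)%N) (w : algC) : w ^+ d = 1 ->
  exists x : Qzeta d, Qzeta_val x = w.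
Proof.
have [nz rz] := Qzeta_root d_gt0; move=> wd.
have [k ->] := prim_rootP (zetaP d_gt0) wd.
exists ((subfx_root _ _ _ : Qzeta d) ^+ k); rewrite rmorphXn; congr (_ ^+ _).
exact: (subfx_inj_root rz nz).
Qed.

(** * Realization over the field of values of the central character *)

Lemma exists_transversal (gT : finGroupType) (G A : {group gT}) n :
    A \subset G -> #|G : A| = n ->
  exists t : 'I_n.-1.+1 -> gT, [/\ forall i, t i \in G,
    forall i j, (t i * (t j)^-1)%g \in A -> i = j
  & forall g, g \in G -> exists j, (g * (t j)^-1)%g \in A].
Proof.
move=> sAG iAG; have n_gt0 : (0 < n)%N by rewrite -iAG indexg_gt0.
have E : n.-1.+1 = #|rcosets A G| by rewrite prednK // -iAG.
pose R i := enum_val (cast_ord E i); pose t i := repr (R i).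
have RE i : A :* t i = R i.
  by have /rcosetsP[x Gx] := enum_valP (cast_ord E i); rewrite /t /R => ->; rewrite rcoset_repr.
have tG i : t i \in G.
  have /rcosetsP[x Gx] := enum_valP (cast_ord E i); rewrite -/(R i) -RE => Ex.
  have /rcosetP[a Aa ->] : t i \in A :* x by rewrite -Ex rcoset_refl.
  by rewrite groupM // (subsetP sAG).
exists t; split=> // [i j Aij | g Gg].
  have Eij : R i = R j.
    by rewrite -!RE; apply/rcoset_eqP; rewrite mem_rcoset.
  by apply: (@cast_ord_inj _ _ E); apply: enum_val_inj.
have Sg : A :* g \in rcosets A G by apply/rcosetsP; exists g.
exists (cast_ord (esym E) (enum_rank_in Sg (A :* g))).
by rewrite -mem_rcoset RE /R cast_ordKV enum_rankK_in // rcoset_refl.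
Qed.

(** The representation induced from mu, written in the basis of a transversal
of A in G: the entry at (i, j) of the image of g is mu (t i * g * (t j)^-1),
understood as 0 off A. Its entries lie in Q(zeta_d) because the values of mu
do. *)
Lemma exists_monomial_repr (gT : finGroupType) (G A : {group gT}) (mu : 'CF(A)) n d :
    A \subset G -> #|G : A| = n -> (0 < d)%N -> mu \is a linear_char ->
    {in A, forall a, mu a ^+ d = 1} ->
  exists rho : gT -> mxalg n (Qzeta d), [/\ rho 1%g = 1,
    {in G &, {morph rho : x y / (x * y)%g >-> x * y}} &
    forall z, z \in A -> z \in 'Z(G) ->
      exists2 w, Qzeta_val w = mu z & rho z = w%:M].
Proof.
move=> sAG iAG d_gt0 linmu mud.
have [t [tG tinj tsurj]] := exists_transversal sAG iAG.
have /fin_all_exists[m mP] : forall x, exists y : Qzeta d, Qzeta_val y = mu x.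
  move=> x; have [Ax | nAx] := boolP (x \in A).
    by have [y Ey] := Qzeta_val_root d_gt0 (mud x Ax); exists y.
  by exists 0; rewrite rmorph0 cfun0.
have injv : injective (@Qzeta_val d) by apply: fmorph_inj.
have m1 : m 1%g = 1 by apply: injv; rewrite mP rmorph1 lin_char1.
have m0 x : x \notin A -> m x = 0 by move=> nAx; apply: injv; rewrite mP rmorph0 cfun0.
have mM a x : a \in A -> m (a * x)%g = m a * m x.
  move=> Aa; apply: injv; rewrite rmorphM /= !mP.
  have [Ax | nAx] := boolP (x \in A); first by rewrite lin_charM.
  by rewrite (cfun0 _ nAx) mulr0 cfun0 // groupMl.
exists (fun g => \matrix_(i, j) m (t i * g * (t j)^-1)%g : 'M[Qzeta d]_n.-1.+1); split.
- apply/matrixP=> i j; rewrite !mxE mulg1; have [<- | ne] := eqVneq i j.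
    by rewrite mulgV m1.
  by rewrite m0 //; apply: contraNN ne => /tinj->.
- move=> g h Gg Gh; apply/matrixP=> i k; rewrite !mxE.
  (* Only the coset that contains t i * g contributes to the product. *)
  have [j0 Aj0] := tsurj (t i * g)%g (groupM (tG i) Gg).
  rewrite (bigD1 j0) //= !mxE big1 ?addr0 => [|j ne]; last first.
    rewrite !mxE m0 ?mul0r //; apply: contraNN ne => Aj; apply/eqP/tinj.
    have -> : (t j * (t j0)^-1 = (t i * g * (t j)^-1)^-1 * (t i * g * (t j0)^-1))%g.
      by rewrite [in RHS]invMg invgK -mulgA mulKg.
    by rewrite groupM ?groupV.
  by rewrite -mM // !mulgA mulgKV.
move=> z Az Zz; exists (m z) => //; apply/matrixP=> i j; rewrite !mxE.
have /centerP[_ cz] := Zz; rewrite -cz // -mulgA mM //.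
have [<- | ne] := eqVneq i j; first by rewrite mulgV m1 mulr1.
have nA : (t i * (t j)^-1)%g \notin A by apply: contraNN ne => /tinj->.
by rewrite (m0 _ nA) mulr0 mulr0n.
Qed.

(** As lam is a class function of Z(G), it is 0 off Z(G). The trace vanishes
there too: such a g has a conjugate of the form g * z with z in Z(G) and lam z
different from 1, which multiplies the trace by lam z. *)
Lemma vz_repr p (gT : finGroupType) (G : {group gT}) (lam : 'CF('Z(G))) (d : nat) :
    prime p -> odd p -> p.-group G -> VZ_group G ->
    lam \is a linear_char -> ~~ (G^`(1)%g \subset cfker lam) -> #[lam]%CF = d ->
  let n := Nat.sqrt #|(G / 'Z(G))%g| in (n ^ 2 = #|G : 'Z(G)%g|)%N /\
  exists rho : gT -> mxalg n (Qzeta d), [/\ rho 1%g = 1,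
    {in G &, {morph rho : x y / (x * y)%g >-> x * y}} &
    {in G, forall g, Qzeta_val (\tr (rho g)) = n%:R * lam g}].
Proof.
move=> pr_p odd_p pG vzG linlam ntlam Dd.
have sG'Z := vz_der_center vzG; have sZG : 'Z(G) \subset G := center_sub G.
have [x G'x nlx] := subsetPn ntlam.
have Zx := subsetP sG'Z x G'x.
have lamx : lam x != 1.
  by apply: contra nlx => lx; rewrite cfkerEchar ?lin_charW // inE Zx lin_char1.
have nondeg g : g \in G :\: 'Z(G) -> exists2 h, h \in G & lam [~ g, h]%g != 1.
  by move=> Zg; have [h Gh E] := vz_commutator vzG Zg G'x; exists h; rewrite ?E.
have d_gt0 : (0 < d)%N by rewrite -Dd cforder_lin_char_gt0.
have lamd : {in 'Z(G), forall z, lam z ^+ d = 1}.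
  by move=> z Zz; rewrite -Dd; apply/dvdn_cforderP.
have pd : (p %| d)%N.
  have pZ : p.-group 'Z(G) := pgroupS sZG pG.
  have d1 : d != 1%N.
    by apply: contraNneq lamx => d1; rewrite -(expr1 (lam x)) -d1 lamd.
  have pnd : p.-nat d by apply: pnat_dvd pZ; rewrite -Dd cforder_lin_char_dvdG.
  have [k Ek] := p_natP pnd; rewrite Ek in d1 *.
  by case: k d1 {Ek} => // k _; rewrite expnS dvdn_mulr.
have [A [mu [sZA sAG linmu muZ [mud cA]]]] :=
  exists_lagrangian sG'Z linlam nondeg pr_p odd_p pG pd lamd.
have iGA : (#|G : A| ^ 2 = #|G : 'Z(G)%g|)%N.
  have /eqP := cA; rewrite -[X in _ == (_ * X)%N](Lagrange sAG) mulnCA eqn_pmul2l //.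
  rewrite -(Lagrange sZA) eqn_pmul2l // => /eqP E.
  by rewrite -(Lagrange_index sAG sZA) E.
move=> n; have Dn : n = #|G : A|.
  rewrite /n card_quotient ?normal_norm ?center_normal // -iGA -mulnn.
  exact: PeanoNat.Nat.sqrt_square.
split; first by rewrite Dn.
have [rho [rho1 rhoM rhoZ]] := exists_monomial_repr sAG (esym Dn) d_gt0 linmu mud.
exists rho; split=> // g Gg.
have n_gt0 : (0 < n)%N by rewrite Dn.
have [Zg | nZg] := boolP (g \in 'Z(G)).
  have [w Ew ->] := rhoZ g (subsetP sZA g Zg) Zg.
  by rewrite mxtrace_scalar raddfMn /= Ew muZ // mulr_natl prednK.
rewrite (cfun0 _ nZg) mulr0; have [|h Gh ne] := nondeg g; first by rewrite inE nZg.
have Zc : [~ g, h]%g \in 'Z(G) by rewrite (subsetP sG'Z) // mem_commg.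
have [w Ew rw] := rhoZ _ (subsetP sZA _ Zc) Zc; rewrite (muZ _ Zc) in Ew.
have : \tr (rho (g ^ h)%g) = \tr (rho g).
  rewrite conjgE !rhoM ?groupM ?groupV // -[_ * _]/(_ *m _) mxtrace_mulC.
  by rewrite -[_ *m _]/(_ * _) -mulrA -rhoM ?groupV // mulgV rho1 mulr1.
rewrite -(mulKVg g (g ^ h)%g) -commgEl rhoM ?groupM ?groupV // rw.
rewrite -[_ * _]/(_ *m _) mul_mx_scalar mxtraceZ => /eqP.
rewrite -subr_eq0 -{2}[\tr _]mul1r -mulrBl mulf_eq0 subr_eq0 => /orP[/eqP w1|/eqP->].
  by case/eqP: ne; rewrite -Ew w1 rmorph1.
by rewrite rmorph0.
Qed.

(** * Representations and components of the rational group algebra *)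

Section GaLift.

Variables (hT : finGroupType) (V : lmodType rat) (rho : hT -> V).

Definition ga_lift (x : group_algebra rat hT) : V := \sum_g x g *: rho g.

Lemma ga_lift_linear : linear ga_lift.
Proof.
move=> a x y; rewrite /ga_lift scaler_sumr -big_split; apply: eq_bigr => g _ /=.
by rewrite !ffunE scalerDl scalerA.
Qed.

End GaLift.

Section GaLiftAlg.

Variables (hT : finGroupType) (B : algType rat) (rho : hT -> B).
Hypotheses (rho1 : rho 1%g = 1) (rhoM : forall g h, rho (g * h)%g = rho g * rho h).

Lemma ga_lift1 : ga_lift rho 1 = 1.
Proof.
rewrite /ga_lift (bigD1 1%g) //= ffunE eqxx scale1r rho1 big1 ?addr0 //.
by move=> g /negPf ng; rewrite ffunE ng scale0r.
Qed.

Lemma ga_liftM x y : ga_lift rho (x * y) = ga_lift rho x * ga_lift rho y.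
Proof.
rewrite /ga_lift mulr_suml.
under eq_bigr => g _ do rewrite ffunE scaler_suml.
rewrite exchange_big; apply: eq_bigr => h _ /=.
rewrite mulr_sumr (reindex_inj (mulgI h)); apply: eq_bigr => g _ /=.
by rewrite mulKg rhoM -scalerAl -scalerAr scalerA.
Qed.

Lemma ga_lift_mulr x h : ga_lift rho x * rho h = \sum_g x g *: rho (g * h)%g.
Proof. by rewrite mulr_suml; apply: eq_bigr => g _; rewrite rhoM scalerAl. Qed.

End GaLiftAlg.

Lemma dsum_lift_morphism (hT : finGroupType) (I : finType) (Alg : I -> algType rat)
    (rho : forall i, hT -> Alg i) :
    (forall i, rho i 1%g = 1) -> (forall i g h, rho i (g * h)%g = rho i g * rho i h) ->
  let f x : dsum Alg := [ffun i => ga_lift (rho i) x : Alg i] in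
  linear f /\ GRing.monoid_morphism f.
Proof.
move=> rho1 rhoM f; split=> [a x y|]; first by apply/ffunP=> i; rewrite !ffunE ga_lift_linear.
split=> [|x y]; apply/ffunP=> i; rewrite !ffunE; first exact: ga_lift1.
exact: ga_liftM.
Qed.

Definition dsum_index (s : seq nat) (a : nat -> nat) := {i : seq_sub s & 'I_(a (ssval i))}.

Lemma sum_dsum_index (s : seq nat) (a F : nat -> nat) : uniq s ->
  (\sum_(t : dsum_index s a) F (ssval (tag t)) = \sum_(d <- s) a d * F d)%N.
Proof.
move=> uniq_s.
rewrite -(@sig_big_dep _ _ _ _ (fun i : seq_sub s => 'I_(a (ssval i))) predT (fun _ => predT)
  (fun i _ => F (ssval i))) /=.
under eq_bigr => i _ do rewrite sum_nat_const card_ord.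
transitivity (\sum_(d <- map val (enum {: seq_sub s})) a d * F d)%N.
  by rewrite big_map big_enum.
apply: perm_big; apply: uniq_perm => //.
  by rewrite map_inj_uniq ?enum_uniq //; exact: val_inj.
move=> d; apply/mapP/idP => [[i _ ->] | sd]; first exact: ssvalP.
by exists (SeqSub sd); rewrite ?mem_enum.
Qed.

(** One component for each cyclic subgroup of S of order in s, given by a
representation rho whose trace, read in the complex numbers through tau, is
the function chi attached to a chosen generator. If x is killed, then the sum
of the x g * tau (rho (g * h)) vanishes, and Galois conjugation carries this
over to every other generator. *)
Lemma exists_component (hT L : finGroupType) (S : {set L}) (s : seq nat) (a : nat -> nat)
    (B : nat -> algType rat) (tau : forall d, B d -> algC) (chi : L -> hT -> algC) :
    (forall u v, u \in S -> <[u]>%g = <[v]>%g -> v \in S) ->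
    (forall d, d \in s -> (0 < d)%N /\ #|elts_of_order S d| = (a d * totient d)%N) ->
    (forall d, (0 < d)%N -> forall q x y, tau d (q *: x + y) = ratr q * tau d x + tau d y) ->
    (forall u d, u \in S -> #[u]%g = d -> exists rho : hT -> B d,
      [/\ rho 1%g = 1, forall g h, rho (g * h)%g = rho g * rho h
        & forall g, tau d (rho g) = chi u g]) ->
    (forall u v, <[u]>%g = <[v]>%g ->
      exists sigma : {rmorphism algC -> algC}, forall g, sigma (chi v g) = chi u g) ->
  exists f : group_algebra rat hT -> dsum (fun t : dsum_index s a => B (ssval (tag t))),
    [/\ linear f, GRing.monoid_morphism f
      & forall x, f x = 0 -> forall u, u \in S -> #[u]%g \in s ->
        forall h, \sum_g ratr (x g) * chi u (g * h)%g = 0].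
Proof.
move=> clS cardS tauL reprS galS.
have /fin_all_exists[rep repP] : forall i : seq_sub s, exists rep : 'I_(a (ssval i)) -> L,
    (forall k, rep k \in S /\ #[rep k]%g = ssval i) /\
    (forall u, u \in S -> #[u]%g = ssval i -> exists k, <[u]>%g = <[rep k]>%g).
  move=> i; have [d_gt0 cd] := cardS _ (ssvalP i).
  exact: cyclic_reps.
have /fin_all_exists[rho rhoP] : forall t : dsum_index s a,
    exists rho : hT -> B (ssval (tag t)),
    [/\ rho 1%g = 1, forall g h, rho (g * h)%g = rho g * rho h
        & forall g, tau _ (rho g) = chi (rep (tag t) (tagged t)) g].
  by move=> [i k] /=; have [/(_ k)[Sk ok] _] := repP i; apply: reprS.
exists (fun x => [ffun t => ga_lift (rho t) x : B (ssval (tag t))]).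
have [||lf mf] := @dsum_lift_morphism hT _ (fun t : dsum_index s a => B (ssval (tag t))) rho.
- by move=> t; case: (rhoP t).
- by move=> t; case: (rhoP t).
split=> // x /ffunP fx0 u Su su h.
have [_ /(_ u Su erefl)[k Ek]] := repP (SeqSub su).
pose t : dsum_index s a := Tagged _ k.
have [sigma sigmaP] := galS _ _ Ek.
have [d_gt0 _] := cardS _ su.
have [_ rhoM tau_rho] := rhoP t.
have : ga_lift (rho t) x * rho t h = 0 by have := fx0 t; rewrite !ffunE => ->; rewrite mul0r.
rewrite ga_lift_mulr // => /(congr1 (@tau _)) E.
have tau0 : tau _ (0 : B (ssval (tag t))) = 0.
  by have := tauL _ d_gt0 (-1) 0 0; rewrite scaler0 addr0 rmorphN1 mulN1r addNr.
have tau_sum : tau _ (\sum_g x g *: rho t (g * h)%g) = \sum_g ratr (x g) * tau _ (rho t (g * h)%g).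
  by elim/big_rec2: _ => // g y1 y2 _ <-; rewrite tauL.
rewrite tau_sum tau0 in E; have := congr1 sigma E; rewrite rmorph0 => {2}<-.
rewrite rmorph_sum; apply: eq_bigr => g _.
by rewrite rmorphM fmorph_rat /= tau_rho sigmaP.
Qed.

Section Components.

Variables (gT : finGroupType) (G : {group gT}).

Lemma exists_linear_component (L : finGroupType) (cF : L -> 'CF(G)) (S : {set L})
    (s : seq nat) (a : nat -> nat) :
    is_dual_group cF ->
    (forall u v, u \in S -> <[u]>%g = <[v]>%g -> v \in S) ->
    (forall d, d \in s -> (0 < d)%N /\ #|elts_of_order S d| = (a d * totient d)%N) ->
  exists f : group_algebra rat (subg_of G) ->
      dsum (fun t : dsum_index s a => Qzeta (ssval (tag t)) : algType rat),
    [/\ linear f, GRing.monoid_morphism f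
      & forall x, f x = 0 -> forall u, u \in S -> #[u]%g \in s ->
        forall h, \sum_g ratr (x g) * cF u (sgval (g * h)%g) = 0].
Proof.
move=> dualL clS cardS; have [injF linF _ [F1 FX FO]] := dualL.
apply: (exists_component (B := fun d => Qzeta d : algType rat)
  (tau := @Qzeta_val) (chi := fun u g => cF u (sgval g))) => //.
- by move=> d d_gt0 q x y; rewrite rmorphD /= Qzeta_valZ.
- move=> u d Su ou; have d_gt0 : (0 < d)%N by rewrite -ou order_gt0.
  have /fin_all_exists[rho rhoP] : forall g : subg_of G,
      exists y : Qzeta d, Qzeta_val y = cF u (sgval g).
    move=> g; apply: Qzeta_val_root => //.
    by rewrite -exp_cfunE ?subgP // -FX -ou expg_order F1 cfun1E subgP.
  have injv : injective (@Qzeta_val d) by apply: fmorph_inj.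
  exists rho; split=> // [|g h]; apply: injv; rewrite ?rmorph1 ?rmorphM /= !rhoP.
    by rewrite lin_char1.
  by rewrite lin_charM ?subgP.
move=> u v E; have [sigma sP] := galois_conjugate dualL E.
by exists sigma => g.
Qed.

Lemma exists_matrix_component p (L : finGroupType) (cF : L -> 'CF('Z(G)))
    (s : seq nat) (a : nat -> nat) :
    prime p -> odd p -> p.-group G -> VZ_group G -> is_dual_group cF ->
    let S := ~: dual_ker cF G^`(1)%g in
    let n := Nat.sqrt #|(G / 'Z(G))%g| in
    (forall d, d \in s -> (0 < d)%N /\ #|elts_of_order S d| = (a d * totient d)%N) ->
  exists f : group_algebra rat (subg_of G) ->
      dsum (fun t : dsum_index s a => mxalg n (Qzeta (ssval (tag t))) : algType rat),
    [/\ linear f, GRing.monoid_morphism f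
      & forall x, f x = 0 -> forall u, u \in S -> #[u]%g \in s ->
        forall h, \sum_g ratr (x g) * (n%:R * cF u (sgval (g * h)%g)) = 0].
Proof.
move=> pr_p odd_p pG vzG dualL S n cardS; have [injF linF _ [F1 FX FO]] := dualL.
apply: (exists_component (S := S) (B := fun d => mxalg n (Qzeta d) : algType rat)
  (tau := fun d X => Qzeta_val (\tr (X : 'M_n.-1.+1)))
  (chi := fun u g => n%:R * cF u (sgval g))) => //.
- move=> u v; rewrite !inE => nSu E; apply: contra nSu => Sv.
  by have := dual_ker_cycle (N := G^`(1)%g) dualL (u := v) (v := u); rewrite !inE; apply.
- move=> d d_gt0 q x y; rewrite [\tr _](_ : _ = q *: \tr (x : 'M_n.-1.+1) + \tr (y : 'M_n.-1.+1)).
    by rewrite rmorphD /= Qzeta_valZ.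
  rewrite /mxtrace scaler_sumr -big_split; apply: eq_bigr => i _.
  by rewrite !mxE.
- move=> u d; rewrite !inE => Su ou.
  have [_ [rho [rho1 rhoM rhoT]]] := vz_repr pr_p odd_p pG vzG (linF u) Su (esym (FO u)).
  rewrite ou in rho rho1 rhoM rhoT.
  exists (fun g => rho (sgval g)); split=> // [g h|g].
    by rewrite rhoM ?subgP.
  by rewrite rhoT ?subgP.
move=> u v E; have [sigma sP] := galois_conjugate dualL E.
by exists sigma => g; rewrite rmorphM rmorph_nat /= sP.
Qed.

End Components.

(** * The regular character *)

Section RegularCharacter.

Variables (gT : finGroupType) (G : {group gT}).
Hypothesis sG'Z : G^`(1)%g \subset 'Z(G).

Variables (L1 L2 : finGroupType) (cF1 : L1 -> 'CF(G)) (cF2 : L2 -> 'CF('Z(G))).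
Hypotheses (dual1 : is_dual_group cF1) (dual2 : is_dual_group cF2).

Let S1 := dual_ker cF1 G^`(1)%g.
Let S2 := ~: dual_ker cF2 G^`(1)%g.

Let nG'Z : G^`(1)%g <| 'Z(G).
Proof. by rewrite /normal sG'Z (subset_trans (center_sub G)) ?der_norm. Qed.

Let Z'1 : ('Z(G)^`(1) = 1)%g.
Proof. exact/derG1P/center_abelian. Qed.

(** The first sum is the index of G' times the indicator of G'. On Z, the second
one is the regular character of Z minus that of Z / G', which corrects the
first one to a multiple of the indicator of 1. *)
Lemma regular_character_sum y : y \in G ->
  \sum_(u in S1) cF1 u y + #|G : 'Z(G)%g|%:R * \sum_(v in S2) cF2 v y
    = (#|G| * (y == 1%g))%:R.
Proof.
move=> Gy.
have E1 : \sum_(u in S1) cF1 u y = (#|G : G^`(1)%g| * (y \in G^`(1)%g))%:R.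
  rewrite -(sum_dual_ker dual1 (der_normal 1 G)) //.
  by apply: eq_bigl => u; rewrite inE.
rewrite E1; have [Zy | nZy] := boolP (y \in 'Z(G)); last first.
  rewrite (_ : (y \in _) = false); last by apply: contraNF nZy; exact: (subsetP sG'Z).
  rewrite (_ : (y == 1%g) = false); last by apply: contraNF nZy => /eqP->.
  by rewrite !muln0 big1 ?mulr0 ?addr0 // => v _; rewrite cfun0.
have E2 : \sum_(v in S2) cF2 v y
    = (#|'Z(G)%g| * (y == 1%g))%:R - (#|'Z(G)%g : G^`(1)%g| * (y \in G^`(1)%g))%:R.
  rewrite -(sum_dual_ker dual2 nG'Z) ?Z'1 ?sub1G //.
  have sZ1 : 'Z(G)^`(1)%g \subset 1%G by rewrite Z'1.
  have := sum_dual_ker dual2 (normal1 'Z(G)) sZ1 Zy.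
  rewrite indexg1 in_set1 => <-.
  rewrite [X in _ = X - _](eq_bigl predT); last by move=> v; rewrite sub1G.
  rewrite [X in X - _](bigID (fun v => v \in S2)) /= -addrA [X in _ + X](_ : _ = 0) ?addr0 //.
  by apply/eqP; rewrite subr_eq0; apply/eqP/eq_bigl => v; rewrite !inE negbK.
rewrite E2 mulrBr -!natrM !mulnA (Lagrange_index (center_sub G) sG'Z).
by rewrite [(_ * #|'Z(G)%g|)%N]mulnC (Lagrange (center_sub G)) addrC subrK.
Qed.

(** This is the preceding formula at 1, where linear characters are 1. *)
Lemma card_regular_sum : (#|S1| + #|G : 'Z(G)%g| * #|S2| = #|G|)%N.
Proof.
have := regular_character_sum (group1 G).
rewrite eqxx muln1 (eq_bigr (fun=> 1)) => [|u _]; last by rewrite lin_char1 //; case: dual1.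
rewrite [in X in _ + X](eq_bigr (fun=> 1)) => [|u _]; last by rewrite lin_char1 //; case: dual2.
by rewrite !sumr_const -natrM -natrD => /eqP; rewrite eqr_nat => /eqP.
Qed.

Lemma card_dual_order_nontrivial d : (0 < d)%N ->
  #|elts_of_order S2 d| = ((num_cyclic_subgroups 'Z(G)%G d
    - num_cyclic_subgroups ('Z(G) / G^`(1))%G d) * totient d)%N.
Proof.
move=> d_gt0; rewrite mulnBl !num_cyclic_totient.
rewrite -(card_dual_order dual2) ?Z'1 ?sub1G //.
rewrite -card_order_quotient1 // -(card_dual_order dual2) ?Z'1 ?sub1G ?normal1 //.
rewrite -(cardsID (elts_of_order (dual_ker cF2 G^`(1)%g) d) (elts_of_order (dual_ker cF2 1%g) d)).
rewrite (setIidPr _); last first.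
  by apply/subsetP=> v; rewrite !inE sub1G => /andP[].
rewrite addKn; apply: eq_card => v; rewrite !inE sub1G.
by case: (_ \subset _); case: (_ == _).
Qed.

End RegularCharacter.

(** * Wedderburn decomposition *)

Local Close Scope ring_scope.

Theorem theorem1 (p : nat) (gT : finGroupType) (G : {group gT}) :
  prime p -> odd p -> p.-group G -> VZ_group G ->
  let m1 := exponent (G / G^`(1)) in
  let m2 := exponent 'Z(G) in
  let m3 := exponent ('Z(G) / G^`(1)) in
  let a1 := num_cyclic_subgroups (G / G^`(1))%G in
  let a2 := num_cyclic_subgroups 'Z(G)%G in
  let a2' := num_cyclic_subgroups ('Z(G) / G^`(1))%G in
  let n := Nat.sqrt #|G / 'Z(G)| in
  exists f : group_algebra rat (subg_of G) ->
      (\bigoplus_(d1 <- divisors m1) (a1 d1) • (Qzeta d1)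
       ⊕ \bigoplus_(d2 <- [seq d <- divisors m2 | ~~ (d %| m3)%N])
           (a2 d2) • (mxalg n (Qzeta d2))
       ⊕ \bigoplus_(d2 <- [seq d <- divisors m2 | (d %| m3)%N])
           (a2 d2 - a2' d2)%N • (mxalg n (Qzeta d2)))%type,
    [/\ (linear f)%R, GRing.monoid_morphism f & bijective f].
Proof.
move=> pr_p odd_p pG vzG m1 m2 m3 a1 a2 a2' n.
have sG'Z := vz_der_center vzG.
have [L1 [cF1 dual1]] := exists_dual_group G.
have [L2 [cF2 dual2]] := exists_dual_group 'Z(G).
pose S1 := dual_ker cF1 G^`(1); pose S2 := ~: dual_ker cF2 G^`(1).
have m1_gt0 : 0 < m1 := exponent_gt0 _; have m2_gt0 : 0 < m2 := exponent_gt0 _.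
have gt0 m d : d \in divisors m -> 0 < d.
  by case: (posnP d) => // ->; case: m => // m; rewrite -dvdn_divisors.
have card1 d : 0 < d -> #|elts_of_order S1 d| = (a1 d * totient d)%N.
  by move=> d_gt0; rewrite num_cyclic_totient -(card_dual_order dual1) ?der_normal.
have card3 d : 0 < d -> #|elts_of_order S2 d| = ((a2 d - a2' d) * totient d)%N.
  exact: card_dual_order_nontrivial.
have card2 d : 0 < d -> ~~ (d %| m3) -> #|elts_of_order S2 d| = (a2 d * totient d)%N.
  move=> d_gt0 nd; rewrite card3 // (_ : a2' d = 0%N) ?subn0 //.
  apply/eqP; apply: contraNT nd => nz; apply: elts_of_order_dvd_exponent.
  rewrite -card_gt0; have := num_cyclic_totient ('Z(G) / G^`(1))%G d => <-.
  by rewrite muln_gt0 lt0n nz totient_gt0.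
have n_gt0 : 0 < n.
  by apply/leP/PeanoNat.Nat.sqrt_le_square/leP; exact: cardG_gt0.
have ord1 u : u \in S1 -> #[u] \in divisors m1.
  move=> Su; rewrite -dvdn_divisors //; apply: (elts_of_order_dvd_exponent (H := (G / G^`(1))%G)).
  rewrite -card_gt0 -(card_dual_order dual1) ?der_normal ?order_gt0 //.
  by rewrite card_gt0; apply/set0Pn; exists u; rewrite inE Su eqxx.
have ord2 (v : L2) : #[v] \in divisors m2.
  rewrite -dvdn_divisors //; apply: (elts_of_order_dvd_exponent (H := 'Z(G)%G)).
  rewrite -card_gt0 -card_order_quotient1 ?order_gt0 //.
  rewrite -(card_dual_order dual2) ?normal1 ?order_gt0 //; last first.
    by rewrite (derG1P (center_abelian G)).
  by rewrite card_gt0; apply/set0Pn; exists v; rewrite !inE sub1G eqxx.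
have [||f1 [lf1 mf1 k1]] :=
    @exists_linear_component _ _ _ cF1 S1 (divisors m1) a1 dual1.
- by move=> u v; apply: dual_ker_cycle.
- by move=> d /gt0 d_gt0; rewrite card1.
have [|f2 [lf2 mf2 k2]] := @exists_matrix_component _ G p _ cF2
    [seq d <- divisors m2 | ~~ (d %| m3)%N] a2 pr_p odd_p pG vzG dual2.
  by move=> d; rewrite mem_filter => /andP[nd /gt0 d_gt0]; rewrite card2.
have [|f3 [lf3 mf3 k3]] := @exists_matrix_component _ G p _ cF2
    [seq d <- divisors m2 | (d %| m3)%N] (fun d => a2 d - a2' d)%N pr_p odd_p pG vzG dual2.
  by move=> d; rewrite mem_filter => /andP[nd /gt0 d_gt0]; rewrite card3.
pose f x := ((f1 x, f2 x), f3 x).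
have lf : (linear f)%R by move=> q x y; rewrite /f lf1 lf2 lf3.
exists f; split=> //.
  split; first by rewrite /f mf1.1 mf2.1 mf3.1.
  by move=> x y; rewrite /f mf1.2 mf2.2 mf3.2.
have inj0 x : f x = 0%R -> x = 0%R.
  case=> fx1 fx2 fx3; apply/ffunP=> g; rewrite [RHS]ffunE.
  have E1 u : u \in S1 -> (\sum_h ratr (x h) * cF1 u (sgval (h * g^-1)%g) = 0)%R.
    by move=> Su; apply: k1 => //; exact: ord1.
  have E2 v : v \in S2 ->
      (\sum_h ratr (x h) * (n%:R * cF2 v (sgval (h * g^-1)%g)) = 0)%R.
    move=> Sv; have [d3 | nd3] := boolP (#[v] %| m3)%N.
      by apply: k3 => //; rewrite mem_filter d3 ord2.
    by apply: k2 => //; rewrite mem_filter nd3 ord2.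
  (* As n is not 0, the factor n of the trace can be removed. *)
  have {}E2 v : v \in S2 -> (\sum_h ratr (x h) * cF2 v (sgval (h * g^-1)%g) = 0)%R.
    move/E2 => E; have nz : (n%:R != 0 :> algC)%R by rewrite pnatr_eq0 -lt0n.
    apply: (mulfI nz); rewrite mulr0 -[RHS]E mulr_sumr; apply: eq_bigr => h _.
    by rewrite mulrCA.
  (* The regular character, evaluated on the translate of x by g^-1, gives the
     coefficient of g. *)
  have E : (\sum_h ratr (x h) * (#|G| * (sgval (h * g^-1)%g == 1%g))%:R = 0 :> algC)%R.
    under eq_bigr => h _ do
      rewrite -(regular_character_sum sG'Z dual1 dual2) ?subgP // mulrDr mulr_sumr mulrCA.
    rewrite big_split /= exchange_big big1 ?add0r //= -mulr_sumr.
    under eq_bigr => h _ do rewrite mulr_sumr.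
    by rewrite exchange_big big1 ?mulr0.
  have nzG : (#|G|%:R != 0 :> algC)%R by rewrite pnatr_eq0 -lt0n cardG_gt0.
  apply/eqP; rewrite -(fmorph_eq0 (@ratr algC)) -(mulIr_eq0 _ (mulIf nzG)) -E.
  rewrite (bigD1 g) //= mulgV eqxx muln1 big1 ?addr0 // => h ne.
  rewrite -eq_mulgV1 (_ : (_ == _) = false) ?muln0 ?mulr0 //.
  by apply: contraNF ne => /eqP/subg_inj->.
pose s2 := [seq d <- divisors m2 | ~~ (d %| m3)%N].
pose s3 := [seq d <- divisors m2 | (d %| m3)%N].
pose a3 d := (a2 d - a2' d)%N.
have dimE : embeds_dim
    (dsum (fun t : dsum_index (divisors m1) a1 => Qzeta (ssval (tag t)) : algType rat)
     * dsum (fun t : dsum_index s2 a2 => mxalg n (Qzeta (ssval (tag t))) : algType rat)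
     * dsum (fun t : dsum_index s3 a3 => mxalg n (Qzeta (ssval (tag t))) : algType rat))%type
    #|subg_of G|.
  have -> : #|subg_of G| =
      (\sum_(t : dsum_index (divisors m1) a1) totient (ssval (tag t))
       + \sum_(t : dsum_index s2 a2) n ^ 2 * totient (ssval (tag t))
       + \sum_(t : dsum_index s3 a3) n ^ 2 * totient (ssval (tag t)))%N.
    have -> : #|subg_of G| = #|G| by rewrite card_sub; apply: eq_card.
    rewrite -[LHS](card_regular_sum sG'Z dual1 dual2).
    have uniqf P : uniq [seq d <- divisors m2 | P d] by rewrite filter_uniq ?divisors_uniq.
    rewrite sum_dsum_index ?divisors_uniq //.
    rewrite (sum_dsum_index a2 (fun d => n ^ 2 * totient d)%N (uniqf _)).
    rewrite (sum_dsum_index a3 (fun d => n ^ 2 * totient d)%N (uniqf _)).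
    rewrite -addnA; congr (_ + _)%N.
      rewrite -(sum_card_elts_of_order (divisors_uniq m1) ord1).
      rewrite big_seq [RHS]big_seq; apply: eq_bigr => d /gt0 d_gt0.
      by rewrite -card1.
    (* A member of S2 has a representation of degree n, which makes n ^ 2 the
       index of the center; without any, both sides are 0. *)
    have -> : (#|G : 'Z(G)| * #|S2| = n ^ 2 * #|S2|)%N.
      have [-> | /set0Pn[v Sv]] := eqVneq S2 set0; first by rewrite cards0 !muln0.
      have [_ linF _ [_ _ FO]] := dual2; move: (Sv); rewrite !inE => ntv.
      by have [<- _] := vz_repr pr_p odd_p pG vzG (linF v) ntv erefl.
    rewrite -(sum_card_elts_of_order (divisors_uniq m2) (fun v _ => ord2 v)).
    rewrite (bigID (fun d => d %| m3)%N) /= addnC mulnDr !big_filter !big_distrr /=.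
    congr (_ + _)%N; rewrite big_seq_cond [RHS]big_seq_cond;
      apply: eq_bigr => d /andP[/gt0 d_gt0 d3].
      by rewrite card2 // mulnCA.
    by rewrite card3 // mulnCA.
  apply: embeds_dim_prod; first apply: embeds_dim_prod.
  - apply: embeds_dim_dsum => -[i k]; apply: embeds_dim_Qzeta; exact: gt0 (ssvalP i).
  - apply: embeds_dim_dsum => -[i k]; apply: embeds_dim_mxalg => //.
    by apply: embeds_dim_Qzeta; have := ssvalP i; rewrite mem_filter => /andP[_ /gt0].
  - apply: embeds_dim_dsum => -[i k]; apply: embeds_dim_mxalg => //.
    by apply: embeds_dim_Qzeta; have := ssvalP i; rewrite mem_filter => /andP[_ /gt0].
apply: (embeds_dim_surj (S := subg_of G) (f := f) dimE lf).
move=> x y E; apply/eqP; rewrite -subr_eq0; apply/eqP/inj0.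
by rewrite addrC -scaleN1r lf E scaleN1r addNr.
Qed.
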